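(* As formal power series, $$\sum_{n=1}^\infty t^n \sum_{\pi\in\mathcal S_n} r^{\mathrm{comp}(\pi)}s^{\mathrm{rmax}(\pi)}x^{p_{\rm silly}(\pi)} = \sum_{n=1}^\infty t^n\sum_{M\in\mathcal N_n} r^{\mathrm{comp}(M)}s^{\min(M)}x^{\mathrm{rne}(M)}$$ $$= \frac{r\sum_{m=1}^\infty\prod_{k=1}^m (x-1)^{-1}\bigl((1+t(x-1))^{k-1}(1+st(x-1))-1\bigr)}{1+(1-r)\sum_{m=1}^\infty\prod_{k=1}^m (x-1)^{-1}\bigl((1+t(x-1))^k-1\bigr)}.$$
   Context: $t,r,s,x$ are commuting variables. Each factor $(x-1)^{-1}(\cdots)$ is a polynomial divisible by $t$, so all sums converge as power series in $t$. **Permutations.** $\mathcal S_n$ is the set of permutations $\pi=\pi(1)\cdots\pi(n)$ of $[n]=\{1,\dots,n\}$. The direct sum $\pi\oplus\pi'$ of permutations of $[n]$ and $[n']$ is $\pi$ followed by $\pi'$ with all entries of $\pi'$ increased by $n$; $\mathrm{comp}(\pi)$ is the number of components in the unique decomposition of $\pi$ as a direct sum of permutations (of sizes $\ge1$) that are not themselves direct sums of two permutations of sizes $\ge 1$. $\mathrm{rmax}(\pi)$ is the number of values $\pi(j)$ with $\pi(j)>\pi(k)$ for all $k>j$. $p_{\rm silly}(\pi)$ is the number of indices $j$ such that $j=1$ or $\pi(j-1)<\pi(j)$, $\pi(j)<n$, and the value $\pi(j)+1$ occurs to the left of $\pi(j)$ in $\pi(1)\cdots\pi(n)$. **Matchings.**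 A matching $M$ of size $n$ is a partition of $[2n]$ into 2-element arcs; an arc $A$ has opener $\mathrm{op}(A)=\min A$ and closer $\mathrm{cl}(A)=\max A$. Arcs are numbered $M_1,\dots,M_n$ by increasing closer. A left nesting is a pair of arcs $A,B$ with $\mathrm{op}(B)<\mathrm{op}(A)<\mathrm{cl}(A)<\mathrm{cl}(B)$ and $\mathrm{op}(A)=\mathrm{op}(B)+1$. $\mathcal N_n$ is the set of matchings of size $n$ with no left nesting. $\mathrm{rne}(M)$ is the number of $i$ with $\mathrm{op}(M_i)<\mathrm{op}(M_{i-1})<\mathrm{cl}(M_{i-1})=\mathrm{cl}(M_i)-1$. $\min(M)=\#\{i:\mathrm{op}(M_i)<\mathrm{cl}(M_1)\}$. The direct sum $M\oplus M'$ is $M$ together with $M'$ with its labels increased by $2n$, where $n$ is the size of $M$; $\mathrm{comp}(M)$ is the number of components in the unique decomposition of $M$ as a direct sum of matchings that are not direct sums of two nonempty matchings. *)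

(* Defs.v *)
From HB Require Import structures.
From mathcomp Require Import boolp classical_sets.
From mathcomp Require Import all_boot all_order all_fingroup all_algebra.
From mathcomp Require Import mpoly.

Set Implicit Arguments.
Unset Strict Implicit.
Unset Printing Implicit Defensive.

Import GRing.Theory.
Local Open Scope ring_scope.

Record fps (K : Type) := Fps { fps_coef :> nat -> K }.

HB.instance Definition _ (K : Type) := gen_eqMixin (fps K).
HB.instance Definition _ (K : Type) := gen_choiceMixin (fps K).

Section FpsRing.
Variable K : comNzRingType.
Implicit Types f g h : fps K.

Lemma fpsP f g : (forall n, f n = g n) -> f = g.
Proof. by case: f g => f [g] /= /funext ->. Qed.

Definition fps0 : fps K := Fps (fun=> 0).
Definition fps_opp f := Fps (fun n => - f n).
Definition fps_add f g := Fps (fun n => f n + g n).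
Definition fpsC (c : K) : fps K := Fps (fun n => if n == 0%N then c else 0).
Definition fps_mul f g := Fps (fun n => \sum_(i < n.+1) f i * g (n - i)%N).

Fact fps_addA : associative fps_add.
Proof. by move=> f g h; apply: fpsP => n /=; rewrite addrA. Qed.
Fact fps_addC : commutative fps_add.
Proof. by move=> f g; apply: fpsP => n /=; rewrite addrC. Qed.
Fact fps_add0 : left_id fps0 fps_add.
Proof. by move=> f; apply: fpsP => n /=; rewrite add0r. Qed.
Fact fps_addN : left_inverse fps0 fps_opp fps_add.
Proof. by move=> f; apply: fpsP => n /=; rewrite addNr. Qed.

HB.instance Definition _ :=
  GRing.isZmodule.Build (fps K) fps_addA fps_addC fps_add0 fps_addN.

Definition trunc N f : {poly K} := \poly_(i < N) f i.

Lemma fps_mulE N n f g : (n < N)%N ->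
  fps_mul f g n = (trunc N f * trunc N g)`_n.
Proof.
move=> lt_nN; rewrite coefM /=; apply: eq_bigr => i _.
rewrite !coef_poly (leq_ltn_trans (leq_ord i) lt_nN).
by rewrite (leq_ltn_trans (leq_subr _ _) lt_nN).
Qed.

Fact fps_mulA : associative fps_mul.
Proof.
move=> f g h; apply: fpsP => n; set P := trunc n.+1.
transitivity ((P f * (P g * P h))`_n).
  rewrite coefM; apply: eq_bigr => i _.
  by rewrite -fps_mulE ?ltnS ?leq_subr // coef_poly ltn_ord.
rewrite mulrA coefM; apply: eq_bigr => i _.
by rewrite -fps_mulE // coef_poly ltnS leq_subr.
Qed.

Fact fps_mulC : commutative fps_mul.
Proof.
by move=> f g; apply: fpsP => n; rewrite !(fps_mulE _ _ (ltnSn n)) mulrC.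
Qed.

Fact fps_mul1 : left_id (fpsC 1) fps_mul.
Proof.
move=> f; apply: fpsP => n /=.
rewrite big_ord_recl /= subn0 mul1r big1 ?addr0 // => i _.
by rewrite mul0r.
Qed.

Fact fps_mulDl : left_distributive fps_mul fps_add.
Proof.
move=> f g h; apply: fpsP => n /=; rewrite -big_split /=.
by apply: eq_bigr => i _; rewrite mulrDl.
Qed.

Fact fps1_neq0 : fpsC 1 != 0.
Proof.
by apply/eqP => /(congr1 (fun f : fps K => f 0%N)) /= /eqP; rewrite oner_eq0.
Qed.

HB.instance Definition _ := GRing.Zmodule_isComNzRing.Build (fps K)
  fps_mulA fps_mulC fps_mul1 fps_mulDl fps1_neq0.

Definition fps_unit : pred (fps K) := fun f => `[< exists g, g * f = 1 >].
Definition fps_inv f : fps K := xget f [set g | g * f = 1]%classic.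

Fact fps_mulV : {in fps_unit, left_inverse 1 fps_inv *%R}.
Proof.
move=> f /asboolP [g gf1]; rewrite /fps_inv.
by have := @xgetPex _ f [set g | g * f = 1]%classic (ex_intro _ g gf1).
Qed.
Fact fps_unitP f g : g * f = 1 -> fps_unit f.
Proof. by move=> gf1; apply/asboolP; exists g. Qed.
Fact fps_inv_out : {in [predC fps_unit], fps_inv =1 id}.
Proof.
move=> f /asboolPn nf; rewrite /fps_inv; case: xgetP => // g _ gf1.
by case: nf; exists g.
Qed.

HB.instance Definition _ := GRing.ComNzRing_hasMulInverse.Build (fps K)
  fps_mulV fps_unitP fps_inv_out.

Definition fpsX : fps K := Fps (fun n => (n == 1%N)%:R).

(* [F m] summed over all m >= 1, coefficientwise: the [n]-th coefficients of
   the partial sums must be eventually constant.  [sum_from1 F] is a junk value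
   if this fails; see [sum_from1P]. *)
Definition is_sum_from1 (F : nat -> fps K) (S : fps K) : Prop :=
  forall n, exists N, forall M, (N <= M)%N ->
    (\sum_(1 <= m < M) F m) n = S n.
Definition sum_from1 (F : nat -> fps K) : fps K := xget 0 (is_sum_from1 F).

Lemma coef_fpsD f g n : (f + g) n = f n + g n. Proof. by []. Qed.
Lemma coef_fpsM f g n : (f * g) n = \sum_(i < n.+1) f i * g (n - i)%N.
Proof. by []. Qed.
Lemma coef_fps_sum (I : Type) (s : seq I) (P : pred I) (F : I -> fps K) n :
  (\sum_(i <- s | P i) F i) n = \sum_(i <- s | P i) F i n.
Proof. exact: (big_morph (fun f : fps K => f n)). Qed.

Lemma is_sum_from1_inj (F : nat -> fps K) S S' :
  is_sum_from1 F S -> is_sum_from1 F S' -> S = S'.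
Proof.
move=> FS FS'; apply: fpsP => n; have [N HN] := FS n; have [N' HN'] := FS' n.
by rewrite -(HN (maxn N N')) ?leq_maxl // HN' // leq_maxr.
Qed.

Lemma sum_from1P (F : nat -> fps K) : (forall m n, (n < m)%N -> F m n = 0) ->
  is_sum_from1 F (sum_from1 F) /\
  forall n, sum_from1 F n = \sum_(1 <= m < n.+1) F m n.
Proof.
move=> F0; set S := Fps (fun n => \sum_(1 <= m < n.+1) F m n).
have FS : is_sum_from1 F S.
  move=> n; exists n.+1 => M le_nM; rewrite coef_fps_sum /=.
  rewrite (big_cat_nat _ (n := n.+1)) //= [X in _ + X]big_nat_cond [X in _ + X]big1 ?addr0 //.
  by move=> m /andP [/andP [lt_nm _] _]; apply: F0.
have FS1 : is_sum_from1 F (sum_from1 F) by apply: (@xgetPex _ 0 (is_sum_from1 F)); exists S.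
by split=> // n; rewrite (is_sum_from1_inj FS1 FS).
Qed.

Lemma fpsM_low f g a b : (forall n, (n < a)%N -> f n = 0) ->
  (forall n, (n < b)%N -> g n = 0) -> forall n, (n < a + b)%N -> (f * g) n = 0.
Proof.
move=> f0 g0 n lt_n; rewrite coef_fpsM big1 // => i _.
have [lt_ia|le_ai] := ltnP i a; first by rewrite f0 // mul0r.
rewrite g0 ?mulr0 // ltn_subLR; last by rewrite -ltnS.
by rewrite (leq_trans lt_n) // leq_add2r.
Qed.

(* [sum_from1P] applies to [fun m => fpsX ^+ m * f m] and to products of [m]
   series without constant term. *)
Lemma fpsXnM_low m f n : (n < m)%N -> (fpsX ^+ m * f) n = 0.
Proof.
move=> lt_nm; apply: (@fpsM_low _ _ m 0) => //; last by rewrite addn0.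
elim: m {lt_nm} => [|m IHm] // k lt_k; rewrite exprS.
by apply: (@fpsM_low _ _ 1 m) => // -[].
Qed.

Lemma fps_prod_low (G : nat -> fps K) m n : (forall k, G k 0%N = 0) ->
  (n < m)%N -> (\prod_(1 <= k < m.+1) G k) n = 0.
Proof.
move=> G0; elim: m n => // m IHm n lt_nm; rewrite big_nat_recr //=.
by apply: (@fpsM_low _ _ m 1) => [||]; rewrite ?addn1 // => -[].
Qed.

Lemma fps_unit_coef1 f : f 0%N = 1 -> f \is a GRing.unit.
Proof.
move=> f0; pose F m := if m == 0%N then 0 else (1 - f) ^+ m.-1.
have u0 n : (n < 1)%N -> (1 - f) n = 0.
  by case: n => // _; rewrite coef_fpsD /= f0 subrr.
have ulow k n : (n < k)%N -> ((1 - f) ^+ k) n = 0.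
  elim: k n => // k IHk n lt_n; rewrite exprS.
  exact: (@fpsM_low _ _ 1 k).
pose g := Fps (fun n => \sum_(k < n.+1) ((1 - f) ^+ k) n).
have gE n N : (n < N)%N -> g n = (\sum_(k < N) (1 - f) ^+ k) n.
  move=> lt_nN; rewrite coef_fps_sum /= -(big_mkord xpredT (fun k => ((1 - f) ^+ k) n)).
  rewrite -[RHS](big_mkord xpredT (fun k => ((1 - f) ^+ k) n)).
  rewrite [RHS](big_cat_nat _ (n := n.+1)) //= [X in _ = _ + X]big_nat_cond [X in _ = _ + X]big1 ?addr0 //.
  by move=> m /andP [/andP [lt_nm _] _]; apply: ulow.
apply/unitrP; suff gf1 : g * f = 1 by exists g; split=> //; rewrite mulrC.
apply: fpsP => n; transitivity (((\sum_(k < n.+1) (1 - f) ^+ k) * f) n).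
  by rewrite !coef_fpsM; apply: eq_bigr => i _; rewrite (gE _ n.+1).
rewrite -{2}(subKr 1 f) -opprB mulrN mulrC -subrX1 opprB coef_fpsD.
by rewrite -[X in _ + X]/(- _) (ulow n.+1 n) // oppr0 addr0.
Qed.

End FpsRing.

Lemma fpsC_unit (K : fieldType) (c : K) : c != 0 -> fpsC c \is a GRing.unit.
Proof.
move=> c0; apply/unitrP; suff cV : fpsC c^-1 * fpsC c = 1.
  by exists (fpsC c^-1); split=> //; rewrite mulrC.
apply: fpsP => -[|n]; rewrite coef_fpsM big_ord_recl /=.
  by rewrite big_ord0 addr0 mulVf.
by rewrite mulr0 add0r big1 // => i _; rewrite mul0r.
Qed.

(* [t] is the variable of the power series,
   whose coefficients lie in the field of fractions of Z[r, s, x]. *)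

Definition coefField : fieldType := {fraction {mpoly int[3]}}.
Definition Series := fps coefField.

Definition coefVar (i : 'I_3) : Series :=
  fpsC (tofrac ('X_i : {mpoly int[3]})).
Definition t : Series := fpsX coefField.
Definition r : Series := coefVar (inord 0).
Definition s : Series := coefVar (inord 1).
Definition x : Series := coefVar (inord 2).

Lemma x1_unit : x - 1 \is a GRing.unit.
Proof.
have -> : x - 1 = fpsC (tofrac ('X_(inord 2) - 1 : {mpoly int[3]})).
  apply: fpsP => -[|n]; rewrite /= ?subr0 ?oppr0 ?addr0 //.
  by rewrite rmorphB rmorph1.
apply: fpsC_unit; rewrite tofrac_eq0; apply/eqP.
move/(congr1 (fun p : {mpoly int[3]} => p.@[fun=> 2%:R])).
by rewrite mevalB mevalXU meval1 meval0.
Qed.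

Section Components.
Variables (T : choiceType) (valid : T -> Prop) (empty : T) (dsum : T -> T -> T).

Definition indecomposable (a : T) : Prop :=
  [/\ valid a, a <> empty &
      ~ exists b c, [/\ valid b, b <> empty, valid c, c <> empty &
                        a = dsum b c]].

Definition is_decomposition (a : T) (l : seq T) : Prop :=
  (forall i, (i < size l)%N -> indecomposable (nth empty l i)) /\
  a = foldr dsum empty l.

(* The number of terms of the (unique) decomposition of [a]. *)
Definition components (a : T) : nat :=
  size (xget [::] [set l | is_decomposition a l]%classic).

End Components.

(* A permutation of [n] is an element of ['S_n]: positions and values are
   numbered from 0 instead of 1. *)

Definition perm_word n (p : 'S_n) : seq nat := [seq val (p i) | i <- enum 'I_n].

Definition is_perm_word (w : seq nat) : Prop :=
  exists n (p : 'S_n), w = perm_word p.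

Definition perm_dsum (w w' : seq nat) : seq nat :=
  w ++ [seq (size w + v)%N | v <- w'].

Definition comp_perm n (p : 'S_n) : nat :=
  components is_perm_word [::] perm_dsum (perm_word p).

Definition rmax n (p : 'S_n) : nat :=
  #|[set p j | j : 'I_n & [forall k : 'I_n, (j < k)%N ==> (p k < p j)%N]]|.

Definition psilly n (p : 'S_n) : nat :=
  #|[set j : 'I_n |
      [&& (val j == 0%N) || [exists i : 'I_n, (i.+1 == j) && (p i < p j)%N],
          ((p j).+1 < n)%N &
          [exists k : 'I_n, (k < j)%N && (val (p k) == (p j).+1)]]]|.

(* A matching of size n is a partition of ['I_n.*2] (labels from 0) into
   two-element sets. *)

Definition is_matching n (M : {set {set 'I_n.*2}}) : bool :=
  partition M [set: 'I_n.*2] && [forall A in M, #|A| == 2%N].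

Definition op n (A : {set 'I_n.*2}) : nat := \big[minn/n.*2]_(i in A) val i.
Definition cl n (A : {set 'I_n.*2}) : nat := \max_(i in A) val i.

(* [arc M i] is the arc numbered i+1 when arcs are ordered by closer. *)
Definition arcs n (M : {set {set 'I_n.*2}}) : seq {set 'I_n.*2} :=
  sort (fun A B => (cl A <= cl B)%N) (enum M).
Definition arc n (M : {set {set 'I_n.*2}}) (i : nat) : {set 'I_n.*2} :=
  nth set0 (arcs M) i.

Definition left_nesting n (A B : {set 'I_n.*2}) : bool :=
  [&& (op B < op A)%N, (op A < cl A)%N, (cl A < cl B)%N & op A == (op B).+1].

Definition noLeftNestings n : {set {set {set 'I_n.*2}}} :=
  [set M : {set {set 'I_n.*2}} | is_matching M &&
     ~~ [exists A in M, [exists B in M, left_nesting A B]]].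

Definition rne n (M : {set {set 'I_n.*2}}) : nat :=
  #|[set i : 'I_n | [&& (0 < i)%N,
      (op (arc M i) < op (arc M i.-1))%N,
      (op (arc M i.-1) < cl (arc M i.-1))%N &
      (cl (arc M i.-1)).+1 == cl (arc M i)]]|.

Definition min_stat n (M : {set {set 'I_n.*2}}) : nat :=
  #|[set i : 'I_n | (op (arc M i) < cl (arc M 0))%N]|.

(* For direct sums, which relate matchings of different sizes, a matching is
   encoded by the list of its arcs (opener, closer), in order of closers. *)
Definition arc_word n (M : {set {set 'I_n.*2}}) : seq (nat * nat) :=
  [seq (op A, cl A) | A <- arcs M].

Definition is_arc_word (w : seq (nat * nat)) : Prop :=
  exists n (M : {set {set 'I_n.*2}}), is_matching M /\ w = arc_word M.

Definition matching_dsum (w w' : seq (nat * nat)) : seq (nat * nat) :=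
  w ++ [seq ((size w).*2 + A.1, (size w).*2 + A.2)%N | A <- w'].

Definition comp_matching n (M : {set {set 'I_n.*2}}) : nat :=
  components is_arc_word [::] matching_dsum (arc_word M).

(* Main.v *)
(* Both families are encoded by codes, i.e. sequences c with c_k <= k (indices from 0), in such a
   way that the components become the cuts of c, and min(M), resp. rmax(pi), the number of zeros
   of c.  Cutting a code after its first component reduces the equation with r to r = 1.

   Put y = x - 1, z = t y.  In a matching, c_k is the number of closers before the opener of the
   (k+1)-st arc, and a right nesting is a descent c_(k-1) > c_k such that no entry equals k.
   Expanding x = 1 + y and forbidding the value k whenever y is chosen gives a transfer recursion,
   solved by h_k = 1 + y^-1 ((1 + z)^(k-1) (1 + s z) - 1) h_(k+1).

   A permutation is built by inserting the values n, n-1, ..., 1, and c_k is the number of larger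
   values to the right of the inserted one.  A value v inserted to the right of v + 1 is counted by
   p_silly iff a smaller value is later inserted in the slot just before v.  The resulting transfer
   recursion does not separate its two state parameters, but the two rightmost slots may be merged
   into a single one of weight s' = 1 + s + s z; hence A(s) = 1 + s t A(1 + s + s z), which unfolds
   to the sum of products as 1 + z s' = (1 + z) (1 + z s). *)
Require Import Defs.
From mathcomp Require Import all_boot all_order all_fingroup all_algebra.
From mathcomp Require Import ring zify.
Import GRing.Theory.
Local Open Scope ring_scope.

(** * Series and transfer recursions *)

Section FormalSums.
Variable K : comNzRingType.
Local Notation R := (fps K).
Local Notation Xt := (fpsX K).
Implicit Types (a b : nat -> R) (f g : R).

Lemma coef_fpsXM f n : (Xt * f) n = if n is n'.+1 then f n' else 0.
Proof.
case: n => [|n]; rewrite coef_fpsM big_ord_recl /= ?big_ord0 mul0r ?addr0 //.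
by rewrite add0r big_ord_recl /= mul1r subSS subn0 big1 ?addr0 // => i _; rewrite mul0r.
Qed.

Definition fps_low n f := forall m, (m < n)%N -> f m = 0.

Lemma fps_lowD n f g : fps_low n f -> fps_low n g -> fps_low n (f + g).
Proof. by move=> f0 g0 m lt_mn; rewrite coef_fpsD f0 ?g0 ?addr0. Qed.

Lemma fps_lowM n f g : fps_low n g -> fps_low n (f * g).
Proof. by move=> g0 m lt_mn; apply: (@fpsM_low _ _ _ 0 n). Qed.

Lemma fps_lowN n f : fps_low n f -> fps_low n (- f).
Proof. by move=> f0; rewrite -mulN1r; apply: fps_lowM. Qed.

Lemma fps_lowB n f g : fps_low n f -> fps_low n g -> fps_low n (f - g).
Proof. by move=> f0 g0; apply/fps_lowD/fps_lowN. Qed.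

Lemma fps_low_sum n (I : Type) (l : seq I) (P : pred I) (F : I -> R) :
  (forall i, P i -> fps_low n (F i)) -> fps_low n (\sum_(i <- l | P i) F i).
Proof. by move=> F0; elim/big_ind: _ => //; apply: fps_lowD. Qed.

Lemma fps_lowXM n f : fps_low n f -> fps_low n.+1 (Xt * f).
Proof. by move=> f0 m; rewrite coef_fpsXM; case: m => // m; apply: f0. Qed.

(** The order of vanishing grows without bound. Uniqueness for recursions with a factor t is proved
    in this way, for all members of a family at once, because the recursions mix them. *)
Lemma fps_low_eq0 (I : Type) (d : I -> R) :
    (forall n, (forall i, fps_low n (d i)) -> forall i, fps_low n.+1 (d i)) ->
  forall i, d i = 0.
Proof.
move=> dS i; apply: fpsP => n; have: forall i, fps_low n.+1 (d i) by elim: n.+1.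
by move/(_ i n (ltnSn n)).
Qed.

(** The sum of [Xt ^+ m * a m] over all [m]. The weights are themselves series in t, so [a m] may
    contribute to every coefficient from [m] on. *)
Definition fpsum a : R := Fps (fun n => \sum_(m < n.+1) a m (n - m)%N).

Lemma fpsum_recl a : fpsum a = a 0%N + Xt * fpsum (fun n => a n.+1).
Proof.
apply: fpsP => n; rewrite coef_fpsD coef_fpsXM /= big_ord_recl subn0.
by case: n => [|n]; rewrite ?big_ord0.
Qed.

Lemma eq_fpsum {a b} : a =1 b -> fpsum a = fpsum b.
Proof. by move=> ab; apply: fpsP => n; apply: eq_bigr => i _; rewrite ab. Qed.

Lemma fpsumD a b : fpsum (fun n => a n + b n) = fpsum a + fpsum b.
Proof. by apply: fpsP => n; rewrite coef_fpsD /= -big_split. Qed.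

Lemma fpsumZ f a : fpsum (fun n => f * a n) = f * fpsum a.
Proof.
apply/eqP; rewrite -subr_eq0; apply/eqP; move: a.
apply: fps_low_eq0 => n IHn a; rewrite fpsum_recl (fpsum_recl a).
(* Peeling off the first terms leaves t times the same difference for the shifted sequence. *)
rewrite (_ : _ - _ = Xt * (fpsum (fun n => f * a n.+1) - f * fpsum (fun n => a n.+1))); last by ring.
exact: fps_lowXM.
Qed.

Lemma fpsumB a b : fpsum (fun n => a n - b n) = fpsum a - fpsum b.
Proof.
rewrite -[in RHS]mulN1r -fpsumZ -fpsumD.
by apply: eq_fpsum => n; rewrite mulN1r.
Qed.

Lemma fpsum_sum (I : Type) (l : seq I) (P : pred I) (F : I -> nat -> R) :
  fpsum (fun n => \sum_(i <- l | P i) F i n) = \sum_(i <- l | P i) fpsum (F i).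
Proof.
elim: l => [|i l IHl].
  by rewrite big_nil; apply: fpsP => n; rewrite /= big1 // => m _; rewrite big_nil.
rewrite big_cons -IHl; case Pi: (P i); rewrite -?fpsumD.
all: by apply: eq_fpsum => n; rewrite big_cons Pi.
Qed.

Lemma fpsumM a b :
  fpsum a * fpsum b = fpsum (fun n => \sum_(i < n.+1) a i * b (n - i)%N).
Proof.
apply/eqP; rewrite -subr_eq0; apply/eqP; move: a.
apply: fps_low_eq0 => n IHn a.
rewrite [X in _ - X](_ : _ = a 0%N * fpsum b +
    Xt * fpsum (fun n => \sum_(i < n.+1) a i.+1 * b (n - i)%N)).
  rewrite (fpsum_recl a).
  set u := fpsum _; set v := fpsum _; set w := fpsum _.
  rewrite (_ : _ - _ = Xt * (u * v - w)); last by ring.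
  exact/fps_lowXM/(IHn (fun n => a n.+1)).
rewrite -fpsumZ [X in _ = X + _]fpsum_recl [LHS]fpsum_recl big_ord_recl big_ord0 /= addr0 -addrA -mulrDr.
congr (_ + _ * _); rewrite -fpsumD; apply: eq_fpsum => m.
by rewrite big_ord_recl.
Qed.

Lemma sum_from1_fpsum a : sum_from1 (fun n => Xt ^+ n * a n) = fpsum a - a 0%N.
Proof.
have [_ coefS] := @sum_from1P K (fun n => Xt ^+ n * a n) (fun m n => @fpsXnM_low K m (a m) n).
have XnM m f n : (m <= n)%N -> (Xt ^+ m * f) n = f (n - m)%N.
  elim: m n => [|m IHm] n; first by rewrite mul1r subn0.
  by case: n => // n le_mn; rewrite exprS -mulrA coef_fpsXM IHm.
rewrite fpsum_recl addrAC subrr add0r.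
apply: fpsP => n; rewrite coefS big_add1 big_mkord coef_fpsXM.
case: n => [|n]; first by rewrite big_ord0.
by apply: eq_bigr => i _; rewrite XnM.
Qed.

(** Unfolding the recursion leaves a remainder that contains a product of ever more series without
    constant term, so it tends to 0 in the t-adic sense. *)
Lemma sum_from1_prod (g h : nat -> R) :
    (forall k, (0 < k)%N -> g k 0%N = 0) ->
    (forall k, (0 < k)%N -> h k = 1 + g k * h k.+1) ->
  sum_from1 (fun m => \prod_(1 <= k < m.+1) g k) = h 1%N - 1.
Proof.
move=> g0 hE; pose F m := \prod_(1 <= k < m.+1) g k.
have Fh N : h 1%N = 1 + \sum_(1 <= m < N.+1) F m + F N.+1 * h N.+2.
  elim: N => [|N IHN]; first by rewrite big_geq // addr0 /F big_nat1 hE.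
  rewrite IHN [in RHS]big_nat_recr //= {1}hE // /F (big_nat_recr N.+2) //=; ring.
have F0 m n : (n < m)%N -> F m n = 0.
  elim: m n => // m IHm n lt_nm; rewrite /F big_nat_recr //=.
  by apply: (@fpsM_low _ _ _ m 1) => [||]; rewrite ?addn1 // => -[] // _; apply: g0.
have [_ coefF] := sum_from1P F0.
apply: fpsP => n; rewrite coefF (_ : h 1%N - 1 = \sum_(1 <= m < n.+1) F m + F n.+1 * h n.+2).
  rewrite coef_fpsD coef_fps_sum.
  by rewrite (@fpsM_low _ _ _ n.+1 0) ?addr0 ?addn0 // => m; apply: F0.
by rewrite (Fh n); ring.
Qed.

(** The value 0 weighs [s], so that a code gets the power of [s] given by its number of zeros. *)
Definition slot_wt (s : R) p : R := if p is 0 then s else 1.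

(** * The transfer recursion of matchings *)

Section Matching.
Variables s y : R.
Local Notation z := (Xt * y).

(* Weighted number of ways to choose [n] further entries of a code when [k] values are allowed
   for the next entry and [j] of them are smaller than the previous entry.  Choosing [y] at a
   descent forbids the value equal to its index, so that the number of allowed values stays [k]. *)
Fixpoint match_fut (n k j : nat) : R :=
  if n is n'.+1 then
    \sum_(p < k) slot_wt s p * match_fut n' k.+1 p + y * \sum_(p < j) slot_wt s p * match_fut n' k p
  else 1.

Definition match_ser k j := fpsum (fun n => match_fut n k j).

Lemma match_serE k j : match_ser k j =
  1 + Xt * (\sum_(p < k) slot_wt s p * match_ser k.+1 p + y * \sum_(p < j) slot_wt s p * match_ser k p).
Proof.
rewrite /match_ser fpsum_recl /= fpsumD fpsumZ !fpsum_sum.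
by do !congr (_ + _ * _); try congr (_ + _ * _); apply: eq_bigr => p _; rewrite fpsumZ.
Qed.

(** Raising [j] by one adds [z * slot_wt s j * match_ser k j] to the right-hand side of the
    recursion, which multiplies the series by [1 + z * slot_wt s j]. *)
Lemma match_ser_prod k j : match_ser k j = \prod_(i < j) (1 + z * slot_wt s i) * match_ser k 0.
Proof.
elim: j => [|j IHj]; first by rewrite big_ord0 mul1r.
rewrite big_ord_recr mulrAC /= -IHj match_serE big_ord_recr [RHS]mulrDr mulr1 /=.
by rewrite {2}(match_serE k j); ring.
Qed.

(** Insert the product formula into the recursion at [j = 0]. The sum telescopes, because each
    summand times [z] is a difference of consecutive products; the factor [y] on the left supplies
    this [z]. *)
Lemma match_ser_rec k :
  y * match_ser k 0 = y + (\prod_(i < k) (1 + z * slot_wt s i) - 1) * match_ser k.+1 0.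
Proof.
rewrite [in LHS]match_serE big_ord0 mulr0 addr0.
under eq_bigr do rewrite match_ser_prod mulrA.
rewrite -mulr_suml mulrDr mulr1 mulrCA !mulrA; congr (_ + _ * _).
elim: k => [|k IHk]; first by rewrite !big_ord0 subrr mulr0.
by rewrite !big_ord_recr mulrDr IHk /=; ring.
Qed.
End Matching.

(** * Inverting $1 - t\theta D$ for the difference operator $D$ *)

Section Resolvent.
Implicit Types (th : R) (u v : nat -> R).

Definition diff u : nat -> R := fun k => u k.+1 - u k.

(** The Neumann series of $(1 - t\theta D)^{-1}$ applied to [u], where $D$ is [diff]. *)
Definition resolvent th u : nat -> R :=
  fun k => fpsum (fun i => th ^+ i * iter i diff u k).

Lemma resolventE th u k : resolvent th u k = u k + Xt * th * diff (resolvent th u) k.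
Proof.
have -> : diff (resolvent th u) k = fpsum (fun i => th ^+ i * iter i.+1 diff u k).
  by rewrite [LHS]/diff -fpsumB; apply: eq_fpsum => i; rewrite -mulrBr.
rewrite /resolvent fpsum_recl mul1r -mulrA -(fpsumZ th); congr (_ + _ * _).
by apply: eq_fpsum => i; rewrite exprS mulrA.
Qed.

(** Injectivity of $1 - t\theta D$: the difference of two preimages is t times a combination of its
    own values. Identities below are proved by applying such an operator to both sides. *)
Lemma resolvent_uniq th u v :
    (forall k, u k - Xt * th * diff u k = v k - Xt * th * diff v k) -> forall k, u k = v k.
Proof.
move=> uv k; apply/eqP; rewrite -subr_eq0; apply/eqP; move: k.
apply: fps_low_eq0 => n IHn k.
rewrite (_ : _ - _ = Xt * (th * ((u k.+1 - v k.+1) - (u k - v k)))).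
  by apply/fps_lowXM/fps_lowM/fps_lowB.
by move/eqP: (uv k); rewrite subr_eq => /eqP uE; rewrite {1}uE /diff; ring.
Qed.
End Resolvent.

(** * The transfer recursion of permutations *)

Section Permutation.
Variable y : R.
Local Notation z := (Xt * y).

(* Weighted number of ways to make [n] further insertions with [k] slots, [j] of which are to the
   right of the last inserted value.  If the slot before that value becomes special, it weighs
   [x] when used and [1] otherwise, that is [x] times an ordinary slot minus [y] times no slot. *)
Fixpoint perm_fut (s : R) (n k j : nat) : R :=
  if n is n'.+1 then
    \sum_(p < k) slot_wt s p * perm_fut s n' k.+1 p.+1 +
    y * \sum_(p < j) slot_wt s p * (perm_fut s n' k.+1 p.+1 - perm_fut s n' k p.+1)
  else 1.

Definition perm_ser s k j := fpsum (fun n => perm_fut s n k j).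

(** The recursion of [perm_ser] as an equation in an unknown family, with [k.+1] slots so that there
    is always one. Stating it for unknowns allows the merged family to be recognized as the solution
    for another weight. *)
Definition perm_ser_eqn s (u : nat -> nat -> R) := forall k j,
  u k j = 1 + Xt * (\sum_(p < k.+1) slot_wt s p * u k.+1 p.+1 +
                    y * \sum_(p < j) slot_wt s p * (u k.+1 p.+1 - u k p.+1)).

Lemma perm_serE s : perm_ser_eqn s (fun k => perm_ser s k.+1).
Proof.
move=> k j; rewrite /perm_ser fpsum_recl /= fpsumD fpsumZ !fpsum_sum.
congr (_ + _ * (_ + _ * _)).
all: by apply: eq_bigr => p _; rewrite fpsumZ ?fpsumB.
Qed.

Lemma perm_ser_eqn_uniq s u v : perm_ser_eqn s u -> perm_ser_eqn s v -> forall k j, u k j = v k j.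
Proof.
move=> uE vE k j; apply/eqP; rewrite -subr_eq0; apply/eqP.
pose d kj := u kj.1 kj.2 - v kj.1 kj.2.
apply: (@fps_low_eq0 _ d _ (k, j)) => n IHn [{}k {}j]; rewrite /d /= uE vE.
rewrite (_ : _ - _ = Xt * (\sum_(p < k.+1) slot_wt s p * d (k.+1, p.+1) +
  y * \sum_(p < j) slot_wt s p * (d (k.+1, p.+1) - d (k, p.+1)))).
  by apply/fps_lowXM/fps_lowD; [|apply: fps_lowM]; apply: fps_low_sum => p _;
     apply/fps_lowM; [|apply: fps_lowB].
have -> : \sum_(p < k.+1) slot_wt s p * d (k.+1, p.+1) =
    \sum_(p < k.+1) slot_wt s p * u k.+1 p.+1 - \sum_(p < k.+1) slot_wt s p * v k.+1 p.+1.
  by rewrite -sumrB; apply: eq_bigr => p _; rewrite -mulrBr.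
have -> : \sum_(p < j) slot_wt s p * (d (k.+1, p.+1) - d (k, p.+1)) =
    \sum_(p < j) slot_wt s p * (u k.+1 p.+1 - u k p.+1)
    - \sum_(p < j) slot_wt s p * (v k.+1 p.+1 - v k p.+1).
  by rewrite -sumrB; apply: eq_bigr => p _; rewrite /d /=; ring.
by ring.
Qed.

(** The equations for [j.+1] and [j] differ in one summand, which gives $(1 - z w_j D)u_{j+1} = u_j$
    with $w_j$ the slot weight. *)
Lemma perm_ser_eqn_step s u j k : perm_ser_eqn s u ->
  u k j.+1 - z * slot_wt s j * diff (u^~ j.+1) k = u k j.
Proof.
by move=> uE; rewrite [u k j.+1]uE [u k j]uE (big_ord_recr j) /= /diff; ring.
Qed.

(* With [D] the difference operator in [k], the series [perm_ser s k.+1 j.+1] is the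
   resolvent [(1 - z s D)^-1 (1 - z D)^-j] of [perm_ser s k.+1 0].  Merging the two
   rightmost slots into one of weight [s' = 1 + s + s z] amounts to the operator identity
   [(1 - z s D) (1 - z D) - z^2 s D (1 + D) = 1 - z s' D]. *)
Section Merge.
Variable s : R.
Local Notation s' := (1 + s + s * z).
Local Notation v := (fun k => perm_ser s k.+1).

(** $w_j = (1 - z s' D)^{-1} v_{j+1}$. Up to a shift of [k], this is the candidate for the merged
    series with [j.+1] slots to the right of the last value. *)
Let w j := resolvent (y * s') (v^~ j.+1).

Let wE j k : w j k - z * s' * diff (w j) k = v k j.+1.
Proof. by rewrite {1}/w resolventE [Xt * (y * s')]mulrA addrK. Qed.

(** Polynomials in $D$ commute, so applying $1 - z s' D$ reduces the claim to the step from [j.+2]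
    to [j.+1] for [v], where the slot weight is 1. *)
Let wS j k : w j.+1 k - z * diff (w j.+1) k = w j k.
Proof.
pose d k := w j.+1 k - z * diff (w j.+1) k; rewrite -/(d k); move: k.
apply: (@resolvent_uniq (y * s')) => k; rewrite [Xt * (y * s')]mulrA wE.
rewrite -[RHS](perm_ser_eqn_step s v j.+1 k (perm_serE s)) /= mulr1 /diff -!wE /d /diff; ring.
Qed.

(** Trades a sum over slots of weights $s', 1, 1, \dots$ for one over slots of weights $s, 1, 1,
    \dots$ with one slot more. The induction step is the operator identity above, applied to
    [w i.+2]. *)
Let merge_sum i k : \sum_(p < i.+1) slot_wt s' p * (w p k - z * s * diff (w p) k)
    - z * s * w i.+1 k.+1 = \sum_(p < i.+2) slot_wt s p * v k p.+1.
Proof.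
elim: i => [|i IHi]; last first.
  rewrite big_ord_recr [RHS]big_ord_recr -IHi /= -wE /diff -!(wS i.+1) /diff; ring.
rewrite !big_ord_recr !big_ord0 /= -!wE /diff -!(wS 0%N) /diff; ring.
Qed.

Lemma perm_ser_merge k : perm_ser s k.+2 1 = perm_ser s' k.+1 0.
Proof.
pose u k j := if j is j'.+1 then w j' k.+1 else v k.+1 1%N.
rewrite -[LHS]/(u k 0%N); apply: perm_ser_eqn_uniq (perm_serE s') k 0%N.
(* The injective operator $1 - z s D$ turns the left-hand side into [v k.+1 0], whose recursion has
   an empty second sum; [merge_sum] identifies its first sum. *)
have u0 k : u k 0%N = 1 + Xt * (\sum_(p < k.+1) slot_wt s' p * u k.+1 p.+1).
  move: k; apply: (@resolvent_uniq (y * s)) => k; rewrite [Xt * (y * s)]mulrA.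
  rewrite [LHS](perm_ser_eqn_step s v 0 k.+1 (perm_serE s)) perm_serE big_ord0 mulr0 addr0.
  rewrite -merge_sum /diff /= [X in _ - _ * (_ + _ * X - _)]big_ord_recr /=.
  have -> : \sum_(p < k.+1) slot_wt s' p * (w p k.+2 - z * s * (w p k.+3 - w p k.+2))
      = \sum_(p < k.+1) slot_wt s' p * w p k.+2 - z * s *
        (\sum_(p < k.+1) slot_wt s' p * w p k.+3 - \sum_(p < k.+1) slot_wt s' p * w p k.+2).
    rewrite -sumrB mulr_sumr -sumrB; apply: eq_bigr => p _; ring.
  ring.
move=> {}k; elim=> [|j IHj]; first by rewrite big_ord0 mulr0 addr0.
(* For larger [j] the equation follows from $(1 - z w'_j D)u_{j+1} = u_j$, which is [wE] at [j = 0]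
   and [wS] beyond. *)
transitivity (u k j + z * slot_wt s' j * diff (u^~ j.+1) k); last first.
  rewrite IHj (big_ord_recr j) /diff /=; ring.
apply/eqP; rewrite -subr_eq; apply/eqP.
by case: j {IHj} => [|j]; [rewrite -[RHS]wE | rewrite -[RHS]wS mulr1].
Qed.

(** The first insertion uses the only slot and leaves two, one on each side of the value; these two
    are merged. *)
Lemma perm_ser_funeq : perm_ser s 1 0 = 1 + Xt * s * perm_ser s' 1 0.
Proof. by rewrite -perm_ser_merge (perm_serE s 0) big_ord1 big_ord0 /=; ring. Qed.
End Merge.

Lemma perm_ser_sum s : sum_from1 (fun m => \prod_(1 <= k < m.+1)
    (Xt * iter k.-1 (fun s => 1 + s + s * z) s)) = perm_ser s 1 0 - 1.
Proof.
pose f s : R := 1 + s + s * z.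
rewrite -[RHS]/(perm_ser (iter 1.-1 f s) 1 0 - 1).
apply: (@sum_from1_prod _ (fun k => perm_ser (iter k.-1 f s) 1 0)) => [k _|[//|k] _].
  by rewrite coef_fpsXM.
by rewrite [LHS]perm_ser_funeq.
Qed.
End Permutation.

(** * The sum of products *)

Definition prod_series (s y : R) := sum_from1 (fun m => \prod_(1 <= k < m.+1)
  (y^-1 * ((1 + Xt * y) ^+ (k - 1) * (1 + s * Xt * y) - 1))).

(** Induction on $1 + z s' = (1 + z)(1 + z s)$. Hence [y^-1] cancels in every factor and leaves a
    multiple of t. *)
Lemma prod_series_factor s y k :
  (1 + Xt * y) ^+ k * (1 + s * Xt * y) - 1 =
  y * (Xt * iter k (fun s => 1 + s + s * (Xt * y)) s).
Proof.
apply/eqP; rewrite subr_eq; apply/eqP.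
elim: k => [|k IHk]; first by rewrite /=; ring.
rewrite exprS -mulrA IHk /=; ring.
Qed.

Lemma prod_seriesE s y : y \is a GRing.unit ->
  prod_series s y = sum_from1 (fun m => \prod_(1 <= k < m.+1)
    (Xt * iter k.-1 (fun s => 1 + s + s * (Xt * y)) s)).
Proof.
move=> yU; congr sum_from1; apply: boolp.funext => m.
by apply: eq_big_nat => k _; rewrite prod_series_factor mulKr // subn1.
Qed.

Lemma perm_ser_refined_prod s y : y \is a GRing.unit -> perm_ser y s 1 0 = 1 + prod_series s y.
Proof. by move=> yU; rewrite prod_seriesE // perm_ser_sum addrC subrK. Qed.

Lemma match_ser_refined_prod s y : y \is a GRing.unit -> match_ser s y 1 0 = 1 + prod_series s y.
Proof.
move=> yU; rewrite prod_seriesE // addrC.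
rewrite (@sum_from1_prod _ (fun k => match_ser s y k 0)) ?subrK // => [k _|[//|k] _].
  by rewrite coef_fpsXM.
apply: (mulrI yU); rewrite match_ser_rec mulrDr mulr1 mulrA -prod_series_factor big_ord_recl /=.
by rewrite big_const_ord iter_mulr_1 mulr1; ring.
Qed.
End FormalSums.

(** * Codes and components *)

(** The parameter [m] is the index of the first entry, hence its bound; [m = 0] gives the codes
    proper, larger [m] their tails. *)
Fixpoint codes_from m n : seq (seq nat) :=
  if n is n'.+1 then [seq i :: c | i <- iota 0 m.+1, c <- codes_from m.+1 n'] else [:: [::]].

Fixpoint is_code m (c : seq nat) : bool :=
  if c is i :: c' then (i <= m)%N && is_code m.+1 c' else true.

Lemma codes_fromS m n :
  codes_from m n.+1 = [seq i :: c | i <- iota 0 m.+1, c <- codes_from m.+1 n].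
Proof. by []. Qed.

Lemma mem_codes_from m n c : (c \in codes_from m n) = (size c == n) && is_code m c.
Proof.
elim: n m c => [|n IHn] m [|i c] //; first by apply/allpairsP => -[[j d] []].
rewrite codes_fromS [size _]/= [is_code _ _]/=.
apply/allpairsP/idP => [[[j d] []]|/and3P[/eqP[sz_c] le_im code_c]].
  by rewrite mem_iota IHn eqSS => /= le_jm /andP[/eqP <- code_d] [-> ->]; rewrite eqxx code_d andbT.
by exists (i, c); rewrite mem_iota IHn sz_c eqxx code_c.
Qed.

Lemma codes_from_size m n c : c \in codes_from m n -> size c = n.
Proof. by rewrite mem_codes_from => /andP[/eqP]. Qed.

Lemma codes_from_code m n c : c \in codes_from m n -> is_code m c.
Proof. by rewrite mem_codes_from => /andP[]. Qed.

Lemma codes_from_uniq m n : uniq (codes_from m n).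
Proof.
elim: n m => // n IHn m; apply: allpairs_uniq; rewrite ?iota_uniq // => -[i c] [j d] _ _ [-> ->] //.
Qed.

Lemma size_codes_from n : size (codes_from 0 n) = n`!.
Proof.
suff sz m : (size (codes_from m n) * m`! = (m + n)`!)%N by rewrite -[LHS]muln1 (sz 0%N).
elim: n m => [|n IHn] m; first by rewrite mul1n addn0.
by rewrite codes_fromS size_allpairs size_iota mulnAC -factS mulnC addnS -addSn IHn.
Qed.

Lemma is_code_cat m c d : is_code m (c ++ d) = is_code m c && is_code (m + size c) d.
Proof.
by elim: c m => [|i c IHc] m /=; rewrite ?addn0 // IHc addSnnS andbA.
Qed.

Lemma is_code_shift j m c : is_code (j + m) (map (addn j) c) = is_code m c.
Proof. by elim: c m => //= i c IHc m; rewrite leq_add2l -addnS IHc. Qed.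

Lemma is_codeP m c :
  reflect (forall k, (k < size c)%N -> (nth 0%N c k <= m + k)%N) (is_code m c).
Proof.
elim: c m => [|i c IHc] m /=; first by left.
apply: (iffP andP) => [[le_im /IHc code_c] [|k] /=|code_c].
- by rewrite addn0.
- by rewrite addnS -addSn => /code_c.
split; first by have := code_c 0%N isT; rewrite addn0.
by apply/IHc => k lt_k; rewrite addSnnS; apply: (code_c k.+1).
Qed.

Definition csum (c d : seq nat) : seq nat := c ++ map (addn (size c)) d.

Lemma size_csum c d : size (csum c d) = (size c + size d)%N.
Proof. by rewrite size_cat size_map. Qed.

Lemma csum0 c : csum c [::] = c. Proof. exact: cats0. Qed.

Lemma csum0l c : csum [::] c = c. Proof. by rewrite /csum -[RHS]map_id. Qed.

Lemma is_code_csum c d : is_code 0 (csum c d) = is_code 0 c && is_code 0 d.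
Proof. by rewrite is_code_cat -[(0 + _)%N]addn0 is_code_shift. Qed.

(** A place where [c] splits as a [csum], after its first [j] entries. The index 0 is always a cut,
    so [ncuts] is the number of components and not of separations. *)
Definition cut (c : seq nat) j := all (leq j) (drop j c).

Definition ncuts c := count (cut c) (iota 0 (size c)).

Lemma cut0 c : cut c 0. Proof. exact/allP. Qed.

Lemma cut_csuml c d j : (j <= size c)%N -> cut (csum c d) j = cut c j.
Proof.
move=> le_jc; rewrite /cut /csum drop_cat; case: ltnP => [lt_j|le_cj].
  rewrite all_cat andb_idr // => _; apply/allP => _ /mapP[i _ ->].
  exact/(leq_trans le_jc)/leq_addr.
have -> : j = size c by lia.
rewrite drop_size subnn drop0; apply/allP => _ /mapP[i _ ->]; exact: leq_addr.
Qed.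

Lemma cut_csumr c d j : cut (csum c d) (size c + j) = cut d j.
Proof.
rewrite /cut /csum drop_cat ltnNge leq_addr /= addKn -map_drop all_map.
by apply: eq_all => i /=; rewrite leq_add2l.
Qed.

Lemma cut_split c j : is_code 0 c -> cut c j -> (j <= size c)%N ->
  exists2 d, c = csum (take j c) d & is_code 0 (take j c) && is_code 0 d.
Proof.
move=> code_c cut_c le_jc.
have c_eq : c = csum (take j c) (map (subn^~ j) (drop j c)).
  rewrite /csum size_takel // -map_comp -{1}(cat_take_drop j c); congr (_ ++ _).
  by rewrite -[LHS]map_id; apply/eq_in_map => i /(allP cut_c) /= le_ji; rewrite subnKC.
by exists (map (subn^~ j) (drop j c)); rewrite // -is_code_csum -c_eq.
Qed.

Lemma ncuts_csum c d : ncuts (csum c d) = (ncuts c + ncuts d)%N.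
Proof.
rewrite /ncuts size_csum iotaD count_cat; congr (_ + _)%N.
  by apply/eq_in_count => j; rewrite mem_iota => /andP[_ lt_j]; rewrite cut_csuml // ltnW.
rewrite add0n -[X in iota X]addn0 iotaDl count_map; apply: eq_count => j /=.
by rewrite cut_csumr.
Qed.

Lemma ncuts_gt0 c : (0 < ncuts c)%N = (c != [::]).
Proof.
by case: c => //= i c; rewrite /ncuts /= cut0.
Qed.

Lemma ncuts_split c : is_code 0 c -> (1 < ncuts c)%N ->
  exists d e, [/\ c = csum d e, is_code 0 d, is_code 0 e, d != [::] & e != [::]].
Proof.
move=> code_c; rewrite /ncuts; case sz_c: (size c) => [//|n] /=.
rewrite cut0 ltnS -has_count => /hasP[j]; rewrite mem_iota => /andP[j0 lt_jn] cut_j.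
have [|e c_eq /andP[code_d code_e]] := cut_split c j code_c cut_j; first by lia.
have sz_take : size (take j c) = j by rewrite size_takel // sz_c; lia.
exists (take j c), e; split=> //; apply/eqP => nil0.
  by move: j0; rewrite -sz_take nil0.
by move/(congr1 size): c_eq; rewrite size_csum sz_take nil0 sz_c /=; lia.
Qed.

Lemma ncuts_take c j : (j <= size c)%N -> cut c j ->
  ncuts (take j c) = count (cut c) (iota 0 j).
Proof.
move=> le_jc cut_j; rewrite /ncuts size_takel //; apply/eq_in_count => i.
rewrite mem_iota => /andP[_ lt_ij]; rewrite -{2}(cat_take_drop j c) /cut drop_cat size_takel //.
rewrite lt_ij all_cat andb_idr // => _; apply: sub_all cut_j => k; apply: leq_trans; exact: ltnW.
Qed.

(** * Sums over codes, and marking a cut *)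

Section CodeSums.
Variable R : comNzRingType.
Implicit Types F : seq nat -> R.

Lemma sum_codesS m n F :
  \sum_(c <- codes_from m n.+1) F c =
  \sum_(i < m.+1) \sum_(c <- codes_from m.+1 n) F (val i :: c).
Proof.
by rewrite codes_fromS big_allpairs_dep -[iota 0 m.+1]/(index_iota 0 m.+1) big_mkord.
Qed.

Lemma sum_codes_cat m a b F :
  \sum_(c <- codes_from m (a + b)) F c =
  \sum_(c <- codes_from m a) \sum_(d <- codes_from (m + a) b) F (c ++ d).
Proof.
elim: a m F => [|a IHa] m F; first by rewrite big_seq1 addn0.
rewrite addSn !sum_codesS; apply: eq_bigr => i _.
by rewrite IHa addSnnS.
Qed.

Lemma sum_codes_shift j m n F :
  \sum_(c <- codes_from (j + m) n | all (leq j) c) F c =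
  \sum_(c <- codes_from m n) F (map (addn j) c).
Proof.
elim: n m F => [|n IHn] m F; first by rewrite big_cons big_nil addr0 big_seq1.
rewrite big_mkcond !sum_codesS -addnS big_split_ord /= big1 ?add0r => [|i _].
  apply: eq_bigr => i _; rewrite -(IHn m.+1 (fun c => F ((j + i)%N :: c))) [RHS]big_mkcond.
  apply: eq_bigr => c _.
  by rewrite leq_addr.
by rewrite big1 // => c _; rewrite leqNgt ltn_ord.
Qed.

Variables (rr : R) (X : seq nat -> R).
Hypothesis Xcsum : forall c d, is_code 0 c -> is_code 0 d -> X (csum c d) = X c * X d.

Definition code_sum (s : R) n := \sum_(c <- codes_from 0 n) s ^+ count_mem 0%N c * X c.

Definition code_csum (s : R) n :=
  \sum_(c <- codes_from 0 n) rr ^+ ncuts c * s ^+ count_mem 0%N c * X c.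

(** Telescoping: an element with property [P] raises the power of [rr] by one and so adds [rr - 1]
    times the power reached before it. For cuts, this marks one cut and weights those before it. *)
Lemma exp_count (P : pred nat) n :
  rr ^+ count P (iota 0 n) = 1 + (rr - 1) * \sum_(j < n | P j) rr ^+ count P (iota 0 j).
Proof.
elim: n => [|n IHn]; first by rewrite big_ord0; ring.
rewrite -addn1 iotaD add0n count_cat exprD IHn addn1 [in RHS]big_mkcond big_ord_recr.
rewrite -big_mkcond /= addn0.
by case: (P n); rewrite ?expr0 ?expr1 ?IHn; ring.
Qed.

(** Expanding [rr ^+ ncuts c] marks a cut [j]. The cut 0 completes [code_sum] to [rr] times itself;
    a cut [j > 0] leaves a prefix that carries the cuts and all zeros, and a suffix weighted by [X]
    alone. *)
Lemma code_csum_rec s n : (0 < n)%N ->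
  code_csum s n = rr * code_sum s n +
    (rr - 1) * \sum_(1 <= j < n) code_csum s j * code_sum 1 (n - j).
Proof.
move=> n0; pose G j c := rr ^+ ncuts (take j c) * s ^+ count_mem 0%N c * X c.
have -> : code_csum s n = code_sum s n +
    (rr - 1) * \sum_(j < n) \sum_(c <- codes_from 0 n | cut c j) G j c.
  rewrite (exchange_big_dep predT) //= mulr_sumr -big_split /=.
  apply: eq_big_seq => c /codes_from_size sz_c.
  rewrite /ncuts sz_c exp_count 2!mulrDl mul1r -!mulrA; congr (_ + _ * _).
  rewrite mulr_suml; apply: eq_bigr => j cut_j.
  by rewrite /G ncuts_take ?sz_c ?(ltnW (ltn_ord j)) // mulrA.
have cutE j : (0 < j < n)%N ->
    \sum_(c <- codes_from 0 n | cut c j) G j c = code_csum s j * code_sum 1 (n - j).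
  move=> /andP[j0 lt_jn]; rewrite big_mkcond -{1}(subnKC (ltnW lt_jn)) sum_codes_cat.
  rewrite mulr_suml; apply: eq_big_seq => c c_in; have sz_c := codes_from_size _ _ _ c_in.
  rewrite mulr_sumr add0n -[X in codes_from X]addn0.
  transitivity (\sum_(d <- codes_from (j + 0) (n - j) | all (leq j) d) G j (c ++ d)).
    by rewrite [RHS]big_mkcond; apply: eq_bigr => d _; rewrite /cut drop_size_cat.
  rewrite sum_codes_shift; apply: eq_big_seq => d d_in.
  rewrite /G take_size_cat // -{2}sz_c -/(csum c d) Xcsum; last 2 first.
  - exact: codes_from_code c_in.
  - exact: codes_from_code d_in.
  (* The shifted suffix has no zeros because [j > 0]; hence the argument 1 of its [code_sum]. *)
  rewrite count_cat count_map [X in (_ + X)%N](@eq_count _ _ pred0) => [|i /=]; last by lia.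
  by rewrite count_pred0 addn0 expr1n mul1r mulrA.
rewrite -[X in _ + (_ - 1) * X](big_mkord predT (fun j => \sum_(c <- codes_from 0 n | cut c j) G j c)).
rewrite big_ltn // mulrDr addrA; congr (_ + _ * _).
  under eq_bigl do rewrite cut0.
  under eq_bigr do rewrite /G take0 mul1r.
  by rewrite -/(code_sum s n); ring.
by apply: eq_big_nat => j /cutE.
Qed.
End CodeSums.

Section CodeSeries.
Variable K : comNzRingType.
Local Notation R := (fps K).
Variables (rr : R) (X : seq nat -> R).
Hypothesis Xcsum : forall c d, is_code 0 c -> is_code 0 d -> X (csum c d) = X c * X d.
Hypothesis X0 : X [::] = 1.

Lemma code_series (s u v : R) :
    fpsum _ (code_sum _ X s) = 1 + u -> fpsum _ (code_sum _ X 1) = 1 + v ->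
    1 + (1 - rr) * v \is a GRing.unit ->
  sum_from1 (fun n => fpsX K ^+ n * code_csum _ rr X s n) = rr * u / (1 + (1 - rr) * v).
Proof.
move=> uE vE den_unit; rewrite sum_from1_fpsum; apply: (canRL (mulrK den_unit)).
(* Without constant terms, the Cauchy product runs over [1 <= j < n] as in [code_csum_rec]. *)
pose pos (a : nat -> R) n := if n is 0 then 0 else a n.
have posE a : a 0%N = 1 -> fpsum _ (pos a) = fpsum _ a - 1.
  by move=> a0; rewrite fpsum_recl [in RHS]fpsum_recl a0 /=; ring.
have f0 : code_csum _ rr X s 0 = 1 by rewrite /code_csum big_seq1 X0 /=; ring.
have a0 s' : code_sum _ X s' 0 = 1 by rewrite /code_sum big_seq1 X0 /=; ring.
rewrite f0 -posE //; set F := fpsum _ _.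
have -> : u = fpsum _ (pos (code_sum _ X s)) by rewrite posE // uE; ring.
have -> : v = fpsum _ (pos (code_sum _ X 1)) by rewrite posE // vE; ring.
set B := fpsum _ _; set A := fpsum _ _.
suff FE : F = rr * A + (rr - 1) * (F * B) by rewrite mulrDr mulr1 {1}FE; ring.
rewrite /F fpsumM -!fpsumZ -fpsumD; apply: eq_fpsum => -[|n].
  by rewrite big_ord1 /=; ring.
rewrite big_ord_recl big_ord_recr /= mul0r subnn mulr0 add0r addr0.
rewrite code_csum_rec // big_add1 big_mkord; congr (_ + _ * _); apply: eq_bigr => i _ /=.
by rewrite subSS /pos; case: (n - i)%N (subn_gt0 i n); rewrite ?ltn_ord.
Qed.
End CodeSeries.

(** * Components of objects that are encoded by codes *)

Section Encoding.
Variables (T : choiceType) (valid : T -> Prop) (empty : T) (dsum : T -> T -> T).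
Variables (enc : seq nat -> T) (op : seq nat -> seq nat -> seq nat).
Hypotheses (dsumA : associative dsum) (dsum0 : left_id empty dsum).
(** The second alternative serves permutations, where the code of the left summand comes last. *)
Hypothesis opE : op = csum \/ op = fun c d => csum d c.
Hypothesis enc_valid : forall c, is_code 0 c -> valid (enc c).
Hypothesis enc0 : forall c, is_code 0 c -> enc c = empty <-> c = [::].
Hypothesis encD : forall c d, is_code 0 c -> is_code 0 d -> enc (op c d) = dsum (enc c) (enc d).
(** Here [b] is arbitrary because it will be the tail of a decomposition, which only this property
    shows to be encoded. *)
Hypothesis enc_dsum : forall c a b, is_code 0 c -> valid a -> enc c = dsum a b ->
  exists d e, [/\ is_code 0 d, is_code 0 e, a = enc d, b = enc e & c = op d e].

Lemma op_ncuts c d : ncuts (op c d) = (ncuts c + ncuts d)%N.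
Proof. by case: opE => ->; rewrite ncuts_csum // addnC. Qed.

Lemma op_size c d : size (op c d) = (size c + size d)%N.
Proof. by case: opE => ->; rewrite size_csum // addnC. Qed.

Lemma op_split c : is_code 0 c -> (1 < ncuts c)%N ->
  exists d e, [/\ c = op d e, is_code 0 d, is_code 0 e, d != [::] & e != [::]].
Proof.
by move=> code_c /(ncuts_split c code_c)[d [e [cE]]]; case: opE => ->; [exists d, e | exists e, d].
Qed.

Lemma indecomposable_enc c : is_code 0 c ->
  indecomposable valid empty dsum (enc c) <-> ncuts c = 1%N.
Proof.
move=> code_c; have enc0c := enc0 c code_c; split=> [[_ c_neq0 indec]|nc1].
  apply/eqP; rewrite eqn_leq ncuts_gt0; apply/andP; split; last first.
    by apply/eqP => c0; apply/c_neq0/enc0c.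
  rewrite leqNgt; apply/negP => /(op_split c code_c)[d [e [cE code_d code_e d0 e0]]].
  apply: indec; exists (enc d), (enc e).
  split; [exact: enc_valid | | exact: enc_valid | | by rewrite cE encD].
    by move/(enc0 d code_d)/eqP; apply/negP.
  by move/(enc0 e code_e)/eqP; apply/negP.
split; [exact: enc_valid | by move/enc0c => c0; rewrite c0 in nc1 |].
move=> [a [b [val_a a0 _ b0 /(enc_dsum c a b code_c val_a)]]].
move=> [d [e [code_d code_e aE bE cE]]].
have : (0 < ncuts d)%N.
  by rewrite ncuts_gt0; apply/eqP => d0; apply: a0; rewrite aE; apply/enc0.
have : (0 < ncuts e)%N.
  by rewrite ncuts_gt0; apply/eqP => e0; apply: b0; rewrite bE; apply/enc0.
by move: nc1; rewrite cE op_ncuts; lia.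
Qed.

Lemma foldr_dsum l b : foldr dsum b l = dsum (foldr dsum empty l) b.
Proof. by elim: l => [|a l /= ->]; rewrite ?dsum0 ?dsumA. Qed.

Lemma decomposition_enc c : is_code 0 c ->
  exists l, is_decomposition valid empty dsum (enc c) l.
Proof.
have [n] := ubnP (size c); elim: n c => // n IHn c; rewrite ltnS => le_cn code_c.
case: (ltngtP (ncuts c) 1) => [|/(op_split c code_c)[d [e [cE code_d code_e d0 e0]]]|nc1].
- rewrite ltnNge ncuts_gt0 negbK => /eqP c0; exists [::]; split=> //=.
  exact/enc0.
- move: le_cn; rewrite cE op_size => le_n.
  have sz_d : (0 < size d)%N by case: (d) d0.
  have sz_e : (0 < size e)%N by case: (e) e0.
  have [|//|l1 [indec1 l1E]] := IHn d; first by lia.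
  have [|//|l2 [indec2 l2E]] := IHn e; first by lia.
  exists (l1 ++ l2); split; last by rewrite foldr_cat foldr_dsum -l1E -l2E encD.
  move=> i; rewrite size_cat nth_cat; case: (ltnP i (size l1)) => [/indec1//|le_i lt_i].
  by apply: indec2; lia.
exists [:: enc c]; split=> [[|//] _|/=]; first exact/indecomposable_enc.
have <- : enc [::] = empty by apply/enc0.
by rewrite -encD //; congr enc; case: opE => ->; rewrite ?csum0 ?csum0l.
Qed.

(** The first term is indecomposable, so its code has one cut; the rest follows by induction. All
    decompositions thus have the same length, whichever one [components] selects. *)
Lemma size_decomposition_enc c l : is_code 0 c ->
  is_decomposition valid empty dsum (enc c) l -> size l = ncuts c.
Proof.
elim: l c => [|a l IHl] c code_c [indec /= cE].
  by move/(enc0 c code_c): cE => ->.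
have indec_a := indec 0%N isT; have [val_a _ _] := indec_a.
have [d [e [code_d code_e aE lE ->]]] := enc_dsum c a _ code_c val_a cE.
rewrite op_ncuts -(IHl e) //; last by split=> // i; apply: (indec i.+1).
by rewrite (_ : ncuts d = 1%N) //; apply/indecomposable_enc; rewrite // -aE.
Qed.

Lemma components_enc c : is_code 0 c -> components valid empty dsum (enc c) = ncuts c.
Proof.
move=> code_c; apply: size_decomposition_enc => //.
have [l dec_l] := decomposition_enc c code_c.
exact: (@classical_sets.xgetPex _ [::] _ (ex_intro _ l dec_l)).
Qed.
End Encoding.

(** * Permutations *)

(* Slots are numbered from right to left; [B] marks the special ones, whose use increases
   [p_silly], and [J] is the number of slots to the right of the last inserted value. *)
Definition split_slot (B : seq bool) (p : nat) (b : bool) :=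
  take p B ++ [:: false, b & drop p.+1 B].

(** The test [i < J] says that the new value goes to the right of its successor, the value inserted
    last; only then does the slot just before it become special. *)
Fixpoint slot_stat (B : seq bool) (J : nat) (c : seq nat) : nat :=
  if c is i :: c' then (nth false B i + slot_stat (split_slot B i (i < J)) i.+1 c')%N else 0%N.

Lemma size_split_slot B p b : (p < size B)%N -> size (split_slot B p b) = (size B).+1.
Proof. by move=> lt_p; rewrite size_cat /= size_take size_drop lt_p; lia. Qed.

Lemma split_slot_catl B B' p b : (p < size B)%N ->
  split_slot (B ++ B') p b = split_slot B p b ++ B'.
Proof.
move=> lt_p; rewrite /split_slot take_cat lt_p drop_cat -!catA /=.
by case: ltnP => // le_B; rewrite (_ : p.+1 = size B) ?subnn ?drop0 ?drop_size //; lia.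
Qed.

Lemma split_slot_catr B B' q b :
  split_slot (B ++ B') (size B + q) b = B ++ split_slot B' q b.
Proof.
rewrite /split_slot take_cat drop_cat.
case: ltnP => [|_]; first by lia.
case: ltnP => [|_]; first by lia.
by rewrite -addnS !addKn -catA.
Qed.

Lemma split_slot_mid B B' b0 b : split_slot (B ++ b0 :: B') (size B) b = B ++ [:: false, b & B'].
Proof. by rewrite -[X in split_slot _ X]addn0 split_slot_catr /split_slot /= drop0. Qed.

Lemma split_slot_consr B B' b0 q b :
  split_slot (B ++ b0 :: B') (size B + q.+1) b = B ++ b0 :: split_slot B' q b.
Proof. by rewrite split_slot_catr. Qed.

Lemma split_slot_nseq k p b : (p < k)%N ->
  split_slot (nseq k false) p b = nseq p.+1 false ++ b :: nseq (k - p.+1) false.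
Proof.
move=> lt_p; have -> : nseq k false = nseq p false ++ false :: nseq (k - p.+1) false.
  by rewrite -{1}(subnKC (ltnW lt_p)) nseqD -(subnSK lt_p).
rewrite -[in X in split_slot _ X](size_nseq p false) split_slot_mid.
by move: (nseq (k - _) _) => B; elim: p {lt_p} => //= p ->.
Qed.

(** * Eliminating the special slots *)

Section SlotSums.
Variables (K : comNzRingType) (s x : fps K).

Fixpoint slot_fut (n : nat) (B : seq bool) (J : nat) : fps K :=
  if n is n'.+1 then
    \sum_(p < size B)
      slot_wt _ s p * x ^+ nth false B p * slot_fut n' (split_slot B p (p < J)%N) p.+1
  else 1.

Lemma slot_futE m n B J : size B = m.+1 ->
  \sum_(c <- codes_from m n) s ^+ count_mem 0%N c * x ^+ slot_stat B J c = slot_fut n B J.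
Proof.
elim: n m B J => [|n IHn] m B J sz_B; first by rewrite big_seq1 /=; ring.
rewrite sum_codesS /= sz_B; apply: eq_bigr => i _.
rewrite -(IHn m.+1) ?size_split_slot ?sz_B // mulr_sumr; apply: eq_bigr => c _ /=.
by case: (val i) => [|p] /=; rewrite ?exprD ?expr1 ?expr0; ring.
Qed.

Lemma sum_split a b (f : nat -> fps K) : \sum_(p < a + b.+1) f p =
  \sum_(p < a) f p + f a + \sum_(q < b) f (a + q.+1)%N.
Proof.
by rewrite big_split_ord big_ord_recl /= addn0 addrA.
Qed.

(** A special slot weighs [x] if it is used and 1 otherwise: [x] times an ordinary slot plus [1 - x]
    times no slot. Since [B1] is nonempty, deleting the slot leaves the rightmost one, of weight
    [s], in place; [J] drops if the slot was counted in it. *)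
Lemma slot_fut_special n B1 B2 J : (0 < size B1)%N ->
  slot_fut n (B1 ++ true :: B2) J =
    x * slot_fut n (B1 ++ false :: B2) J
    + (1 - x) * slot_fut n (B1 ++ B2) (J - (size B1 < J)%N).
Proof.
elim: n B1 B2 J => [|n IHn] B1 B2 J B1_gt0; first by rewrite /=; ring.
pose f B J' p := slot_wt _ s p * x ^+ nth false B p * slot_fut n (split_slot B p (p < J')%N) p.+1.
have futS B J' : slot_fut n.+1 B J' = \sum_(p < size B) f B J' p by [].
have fl p : (p < size B1)%N -> f (B1 ++ true :: B2) J p =
    x * f (B1 ++ false :: B2) J p + (1 - x) * f (B1 ++ B2) (J - (size B1 < J))%N p.
  move=> lt_p; rewrite /f !split_slot_catl // !nth_cat lt_p IHn ?size_split_slot //.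
  have -> : (p < J - (size B1 < J)%N)%N = (p < J)%N by case: (ltnP (size B1) J) => /=; lia.
  have -> : (p.+1 - ((size B1).+1 < p.+1))%N = p.+1 by case: ltnP => /=; lia.
  by ring.
(* Using the special slot itself has no counterpart once the slot is deleted. *)
have fm : f (B1 ++ true :: B2) J (size B1) = x * f (B1 ++ false :: B2) J (size B1).
  by rewrite /f !split_slot_mid !nth_cat !ltnn !subnn /= expr1 expr0; ring.
have fr q : f (B1 ++ true :: B2) J (size B1 + q.+1)%N =
    x * f (B1 ++ false :: B2) J (size B1 + q.+1)%N
    + (1 - x) * f (B1 ++ B2) (J - (size B1 < J))%N (size B1 + q)%N.
  rewrite /f (split_slot_consr _ _ true) (split_slot_consr _ _ false) split_slot_catr.
  rewrite !nth_cat ![(size B1 + _ < size B1)%N]ltnNge !leq_addr /= !addKn.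
  have -> : (size B1 + q < J - (size B1 < J)%N)%N = (size B1 + q.+1 < J)%N.
    by case: (ltnP (size B1) J) => /=; lia.
  rewrite (IHn B1 (split_slot B2 q _) _ B1_gt0).
  have -> : ((size B1 + q.+1).+1 - (size B1 < (size B1 + q.+1).+1))%N = (size B1 + q).+1.
    by case: ltnP => /=; lia.
  by case: (size B1) B1_gt0 => //= n' _; ring.
rewrite !futS !size_cat (sum_split _ _ (f (B1 ++ true :: B2) J)).
rewrite (sum_split _ _ (f (B1 ++ false :: B2) J)) big_split_ord /=.
under eq_bigr do rewrite fl ?ltn_ord //.
under [X in _ + X = _]eq_bigr do rewrite fr.
rewrite fm !big_split -!mulr_sumr /=; ring.
Qed.

(** A special slot is eliminated as soon as it arises, so the states have ordinary slots only and
    are described by [k] and [j]. *)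
Lemma slot_fut_plain n k j : (j <= k)%N ->
  slot_fut n (nseq k false) j = perm_fut _ (x - 1) s n k j.
Proof.
elim: n k j => // n IHn k j le_jk /=; rewrite size_nseq.
rewrite (big_ord_widen k (fun p => slot_wt _ s p *
  (perm_fut _ (x - 1) s n k.+1 p.+1 - perm_fut _ (x - 1) s n k p.+1))) //.
rewrite [X in _ + _ * X]big_mkcond mulr_sumr -big_split; apply: eq_bigr => p _ /=.
have lt_p := ltn_ord p; rewrite nth_nseq lt_p expr0.
rewrite split_slot_nseq //.
case: (p < j)%N; rewrite ?slot_fut_special ?size_nseq // ?ltnn ?subn0.
all: rewrite -[false :: _]/(nseq (k - p.+1).+1 false) -!nseqD -?subSn // ?subnKC //; last by lia.
all: rewrite !IHn //; try lia; try ring.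
Qed.
End SlotSums.

(* Words are reversed: [rins v i] inserts a new minimum with [i] values to its right. *)
Fixpoint rins (v : seq nat) (i : nat) {struct i} : seq nat :=
  if i is i'.+1 then if v is e :: v' then e.+1 :: rins v' i' else [:: 0%N]
  else 0%N :: map S v.

(** In the reversed word, [v'] is what stands to the left of [e], and its head is the left
    neighbour. The default 0 of [head] has no effect, as [e.+1 \in v'] fails for empty [v']. *)
Fixpoint rsilly (v : seq nat) : nat :=
  if v is e :: v' then ((e.+1 \in v') && (head 0%N v' < e) + rsilly v')%N else 0%N.

(** The mark of the slot just before each entry [e]: a smaller value inserted there makes [e] count
    for [rsilly]. The rightmost slot, never special, is added as [false ::] where this is used. *)
Fixpoint slots (v : seq nat) : seq bool :=
  if v is e :: v' then (e.+1 \in v') && (e < head 0%N v')%N :: slots v' else [::].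

(** Counts the records of [v] that reach the threshold [m]; on a reversed word these are the
    right-to-left maxima. *)
Fixpoint lrmax (m : nat) (v : seq nat) : nat :=
  if v is e :: v' then ((m <= e) + lrmax (maxn m e.+1) v')%N else 0%N.

Lemma mapS_mem e v : (e.+1 \in map S v) = (e \in v).
Proof. exact/mem_map/succn_inj. Qed.

Lemma perm_rins v i : perm_eq (rins v i) (0%N :: map S v).
Proof.
elim: v i => [|e v IHv] [|i] //=.
by rewrite perm_sym -[_ :: _]/([:: 0%N] ++ [:: e.+1] ++ map S v) perm_catCA perm_cons perm_sym.
Qed.

Lemma size_rins v i : size (rins v i) = (size v).+1.
Proof. by rewrite (perm_size (perm_rins v i)) /= size_map. Qed.

Lemma mem_rins e v i : (e.+1 \in rins v i) = (e \in v).
Proof. by rewrite (perm_mem (perm_rins v i)) inE mapS_mem. Qed.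

Lemma rins_uniq v i : uniq (rins v i) = uniq v.
Proof.
rewrite (perm_uniq (perm_rins v i)) /= (map_inj_uniq succn_inj).
by rewrite (_ : 0%N \notin _) //; apply/mapP => -[].
Qed.

Lemma head_rins v i : (0 < i)%N -> v != [::] -> head 0%N (rins v i) = (head 0%N v).+1.
Proof. by case: v i => [|e v] [|i]. Qed.

Lemma rsilly_mapS v : rsilly (map S v) = rsilly v.
Proof. by elim: v => //= e v ->; rewrite mapS_mem; case: v. Qed.

Lemma rsilly_cons0 v : rsilly (0%N :: map S v) = rsilly v.
Proof. by rewrite [LHS]/= ltn0 andbF rsilly_mapS. Qed.

Lemma slots_mapS v : slots (map S v) = slots v.
Proof. by elim: v => //= e v ->; rewrite mapS_mem; case: v. Qed.

Lemma lrmax_mapS m v : lrmax m.+1 (map S v) = lrmax m v.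
Proof. by elim: v m => //= e v IHv m; rewrite ltnS maxnSS IHv. Qed.

(** Only the entry just to the right of the new minimum gets a new left neighbour, and the minimum
    itself has no smaller one. *)
Lemma rsilly_rins v i : uniq v -> (i <= size v)%N ->
  rsilly (rins v i) = (rsilly v + nth false (false :: slots v) i)%N.
Proof.
elim: v i => [|e v IHv] [|i] //.
  by rewrite -[rins _ _]/(0%N :: map S (e :: v)) rsilly_cons0 addn0.
rewrite /=.
move=> /andP[e_v uniq_v]; rewrite ltnS => le_i; rewrite mem_rins IHv //.
case: v i e_v uniq_v le_i {IHv} => [|f v] [|i] //= e_v _ _; last by rewrite ltnS addnA.
move: e_v; rewrite inE negb_or => /andP[+ _].
by case: (e.+1 \in _); case: (ltngtP e f) => //= _ _; lia.
Qed.

Lemma slots_cons e v : slots (e :: v) = (e.+1 \in v) && (e < head 0%N v)%N :: slots v.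
Proof. by []. Qed.

Lemma slots_rins v i : (i <= size v)%N ->
  false :: slots (rins v i) = split_slot (false :: slots v) i (0%N \in drop i v).
Proof.
have slots0 u : false :: slots (0%N :: map S u) = split_slot (false :: slots u) 0 (0%N \in drop 0 u).
  by rewrite /split_slot /= mapS_mem slots_mapS !drop0; case: u => //= e u; rewrite andbT.
elim: v i => [|e v IHv] [|i] //; first by rewrite -[rins _ _]/(0%N :: map S (e :: v)) slots0.
rewrite ltnS => le_i; have := IHv i le_i.
rewrite -[rins (e :: v) _]/(e.+1 :: rins v i) -[drop _ (e :: v)]/(drop i v) !slots_cons mem_rins.
case: i le_i => [|i] le_i; first by rewrite /= ltn0 andbF => ->.
rewrite head_rins ?ltnS //; last by case: (v) le_i.
by rewrite /split_slot /= => -[->].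
Qed.

(** The number [J] of slots to the right of the value 0, which is the value inserted last. *)
Definition last_pos (v : seq nat) := if 0%N \in v then (index 0%N v).+1 else 0%N.

Lemma mem0_drop v i : uniq v -> (0%N \in drop i v) = (i < last_pos v)%N.
Proof.
rewrite /last_pos; elim: v i => [|e v IHv] [|i] //= /andP[e_v uniq_v].
  by case: ifP.
rewrite IHv // inE; case: e e_v => [|e] e_v /=; first by rewrite (negPf e_v).
by case: ifP.
Qed.

Lemma last_pos_rins v i : (i <= size v)%N -> last_pos (rins v i) = i.+1.
Proof.
rewrite /last_pos (perm_mem (perm_rins v i)) inE eqxx /= => le_i; congr _.+1.
by elim: v i le_i => [|e v IHv] [|i] //= /IHv ->.
Qed.

Lemma lrmax_rins m v i : lrmax m.+1 (rins v i) = lrmax m v.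
Proof.
have cons0 u : lrmax m.+1 (0%N :: map S u) = lrmax m u by rewrite [LHS]/= maxnSS maxn0 lrmax_mapS.
elim: v m i cons0 => [|e v IHv] m [|i] cons0 //; first exact: cons0 (e :: v).
by rewrite /= ltnS maxnSS IHv // => u; rewrite [LHS]/= maxnSS maxn0 lrmax_mapS.
Qed.

Lemma lrmax0_rins v i : (i <= size v)%N -> lrmax 0 (rins v i) = ((i == 0) + lrmax 0 v)%N.
Proof.
case: i => [|i]; first by move=> _; rewrite [LHS]/= max0n lrmax_mapS.
by case: v => //= e v _; rewrite !max0n lrmax_rins.
Qed.

Definition code_word (c : seq nat) := foldl rins [::] c.

Lemma size_foldl_rins v c : size (foldl rins v c) = (size v + size c)%N.
Proof. by elim: c v => [|i c IHc] v /=; rewrite ?addn0 // IHc size_rins addSnnS. Qed.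

Lemma rsilly_foldl v c : uniq v -> is_code (size v) c ->
  rsilly (foldl rins v c) = (rsilly v + slot_stat (false :: slots v) (last_pos v) c)%N.
Proof.
elim: c v => [|i c IHc] v uniq_v; rewrite ?addn0 // => /andP[le_i code_c].
rewrite /= IHc ?rins_uniq ?size_rins // rsilly_rins // slots_rins // last_pos_rins //.
by rewrite mem0_drop // addnA.
Qed.

Lemma lrmax_foldl v c : is_code (size v) c ->
  lrmax 0 (foldl rins v c) = (lrmax 0 v + count_mem 0%N c)%N.
Proof.
elim: c v => [|i c IHc] v /=; rewrite ?addn0 // => /andP[le_i code_c].
by rewrite IHc ?size_rins // lrmax0_rins // [(_ + lrmax _ _)%N]addnC addnA.
Qed.

Lemma code_word_sum (K : comNzRingType) (s x : fps K) :
  fpsum _ (code_sum _ (fun c => x ^+ rsilly (code_word c)) s) = perm_ser _ (x - 1) s 1 0.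
Proof.
apply: eq_fpsum => n; rewrite -slot_fut_plain // -(slot_futE _ _ _ 0) //.
by apply: eq_big_seq => c /codes_from_code code_c; rewrite rsilly_foldl.
Qed.

Lemma foldl_rins_cat u v c :
  foldl rins (u ++ v) (map (addn (size u)) c) = map (addn (size c)) u ++ foldl rins v c.
Proof.
have rins_cat w w' i : rins (w ++ w') (size w + i) = map S w ++ rins w' i.
  by elim: w => //= e w ->.
elim: c u v => [|i c IHc] u v; first by rewrite -[in LHS](map_id u).
rewrite /= rins_cat -(size_map S u) IHc -map_comp; congr (_ ++ _).
by apply: eq_map => j /=; rewrite addnS.
Qed.

(** The insertions of [d] all happen to the left of the values of [c] and raise these by [size d].
    So [csum] becomes the direct sum in the opposite order. *)
Lemma code_word_csum c d :
  code_word (csum c d) = map (addn (size d)) (code_word c) ++ code_word d.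
Proof.
rewrite /code_word foldl_cat -{1}[foldl _ _ c]cats0.
by rewrite -(foldl_rins_cat _ [::]) size_foldl_rins.
Qed.

Lemma size_code_word c : size (code_word c) = size c.
Proof. exact: size_foldl_rins. Qed.

Lemma perm_code_word c : perm_eq (code_word c) (iota 0 (size c)).
Proof.
elim/last_ind: c => // c i IHc; rewrite /code_word -cats1 foldl_cat size_cat addn1 /=.
apply: perm_trans (perm_rins _ _) _; rewrite perm_cons (iotaDl 1 0).
exact: perm_map.
Qed.

Lemma mem_code_word c e : (e \in code_word c) = (e < size c)%N.
Proof. by rewrite (perm_mem (perm_code_word c)) mem_iota. Qed.

Lemma rsilly_cat_shift u v n : all (fun e => e < n)%N v ->
  rsilly (map (addn n) u ++ v) = (rsilly u + rsilly v)%N.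
Proof.
move=> v_lt; elim: u => //= e u ->; rewrite addnA; congr (_ + _ + _)%N.
rewrite mem_cat -addnS mem_map; last exact: addnI.
rewrite [_ \in v](_ : _ = false) ?orbF.
  by case: u => //= f u; rewrite ltn_add2l.
by apply/negP => /(allP v_lt); lia.
Qed.

Lemma rsilly_csum c d :
  rsilly (code_word (csum c d)) = (rsilly (code_word c) + rsilly (code_word d))%N.
Proof.
rewrite code_word_csum rsilly_cat_shift //; apply/allP => e.
by rewrite mem_code_word.
Qed.

Lemma rins_surj v : 0%N \in v -> uniq v ->
  exists u i, [/\ v = rins u i & (i <= size u)%N].
Proof.
elim: v => // -[|e] v IHv.
  move=> _ /andP[v0 _]; exists (map predn v), 0%N; split=> //=.
  congr (_ :: _); rewrite -map_comp -[LHS]map_id; apply/eq_in_map => -[|j] //.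
  by rewrite (negPf v0).
rewrite inE /= => v0 /andP[_ uniq_v]; have [u [i [-> le_i]]] := IHv v0 uniq_v.
by exists (e :: u), i.+1.
Qed.

Lemma code_word_surj n v : perm_eq v (iota 0 n) ->
  exists c, [/\ is_code 0 c, size c = n & v = code_word c].
Proof.
elim: n v => [|n IHn] v perm_v; first by exists [::]; split=> //; apply/nilP/eqP/(perm_size perm_v).
have v0 : 0%N \in v by rewrite (perm_mem perm_v) mem_iota.
have uniq_v : uniq v by rewrite (perm_uniq perm_v) iota_uniq.
have [u [i [vE le_i]]] := rins_surj v v0 uniq_v.
have [|c [code_c sz_c uE]] := IHn u.
  apply: (perm_map_inj succn_inj); rewrite -(perm_cons 0%N) -(iotaDl 1 0).
  by rewrite -(permPl (perm_rins u i)) -vE.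
exists (rcons c i); rewrite -cats1 is_code_cat code_c /= size_cat sz_c addn1 add0n.
rewrite /code_word foldl_cat vE uE; split=> //.
by move: le_i; rewrite uE size_code_word sz_c andbT.
Qed.

(** * Words of permutations and their statistics *)

Section PermWords.
Variable n : nat.
Implicit Type p : 'S_n.

Lemma size_perm_word p : size (perm_word p) = n.
Proof. by rewrite size_map size_enum_ord. Qed.

Lemma nth_perm_word p (j : 'I_n) : nth 0%N (perm_word p) j = p j.
Proof. by rewrite (nth_map j) ?size_enum_ord // nth_ord_enum. Qed.

Lemma perm_word_iota p : perm_eq (perm_word p) (iota 0 n).
Proof.
rewrite -val_enum_ord /perm_word (map_comp val p); apply: perm_map.
apply: uniq_perm => [||i]; [by rewrite (map_inj_uniq perm_inj) enum_uniq | exact: enum_uniq |].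
by rewrite mem_enum; apply/mapP; exists (p^-1%g i); rewrite ?mem_enum // permKV.
Qed.

Lemma perm_word_inj : injective (@perm_word n).
Proof.
by move=> p q pq; apply/permP => j; apply: val_inj; rewrite /= -!nth_perm_word pq.
Qed.

(** Every word comes from a code, and both lists have n! entries; so distinct codes have distinct
    words too. *)
Lemma perm_words_codes :
  perm_eq [seq perm_word p | p <- enum 'S_n] [seq rev (code_word c) | c <- codes_from 0 n].
Proof.
have uniq1 : uniq [seq perm_word p | p <- enum 'S_n].
  by rewrite map_inj_uniq ?enum_uniq //; apply: perm_word_inj.
have sub12 : {subset [seq perm_word p | p <- enum 'S_n] <=
    [seq rev (code_word c) | c <- codes_from 0 n]}.
  move=> _ /mapP[p _ ->]; have [|c [code_c sz_c wE]] := code_word_surj n (rev (perm_word p)).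
    by rewrite perm_rev perm_word_iota.
  by apply/mapP; exists c; rewrite ?mem_codes_from ?sz_c ?eqxx // -wE revK.
have sz : (size [seq rev (code_word c) | c <- codes_from 0 n] <=
    size [seq perm_word p | p <- enum 'S_n])%N.
  by rewrite size_map size_codes_from [leqRHS]size_map -cardE card_Sn.
have [_ eq12] := uniq_min_size uniq1 sub12 sz.
exact: uniq_perm uniq1 (leq_size_uniq uniq1 sub12 sz) eq12.
Qed.

Lemma card_ord_count (P : pred nat) : #|[set j : 'I_n | P j]| = count P (iota 0 n).
Proof.
transitivity (\sum_(0 <= j < n | P j) 1)%N; last by rewrite /index_iota subn0 sum1_count.
by rewrite big_mkord -sum1_card; apply: eq_bigl => j; rewrite inE.
Qed.

Lemma card_ord_rev (P : pred 'I_n) : #|[set j | P j]| = #|[set j | P (rev_ord j)]|.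
Proof.
rewrite -(card_imset _ (@rev_ord_inj n)); apply: eq_card => j.
rewrite inE; apply/imsetP/idP => [[k + ->]|Pj]; first by rewrite inE rev_ordK.
by exists (rev_ord j); rewrite ?rev_ordK // inE.
Qed.
End PermWords.

Lemma lrmax_rcons m v e : lrmax m (rcons v e) = (lrmax m v + ((m <= e) && all (fun i => i < e) v))%N.
Proof.
elim: v m => [|i v IHv] m /=; first by rewrite andbT addn0.
by rewrite IHv geq_max -addnA andbA.
Qed.

Lemma lrmax_rev w : lrmax 0 (rev w) =
  count (fun j => all (fun i => i < nth 0%N w j)%N (drop j.+1 w)) (iota 0 (size w)).
Proof.
elim: w => // e w IHw; rewrite rev_cons lrmax_rcons IHw all_rev /= drop0 addnC; congr (_ + _)%N.
by rewrite (iotaDl 1 0) count_map.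
Qed.

Lemma rsilly_count v : rsilly v =
  count (fun j => ((nth 0%N v j).+1 \in drop j.+1 v) &&
    (nth 0%N v j.+1 < nth 0%N v j)%N) (iota 0 (size v)).
Proof.
elim: v => // e v IHv; rewrite [LHS]/= IHv /= drop0 nth0; congr (_ + _)%N.
by rewrite (iotaDl 1 0) count_map.
Qed.

Lemma rmax_lrmax n (p : 'S_n) : rmax p = lrmax 0 (rev (perm_word p)).
Proof.
rewrite /rmax card_imset; last exact: perm_inj.
rewrite lrmax_rev size_perm_word -card_ord_count -cardsE; apply: eq_card => j; rewrite !inE.
rewrite nth_perm_word.
apply/forallP/allP => [max_j e|max_j k].
  case/(nthP 0%N) => i; rewrite size_drop size_perm_word nth_drop => lt_i <-.
  have lt_k : (j.+1 + i < n)%N by lia.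
  rewrite -[(j.+1 + i)%N]/(val (Ordinal lt_k)) nth_perm_word.
  by apply: (implyP (max_j _)); rewrite /=; lia.
apply/implyP => lt_jk; apply: max_j; rewrite -nth_perm_word.
rewrite -(subnKC lt_jk) -nth_drop mem_nth // size_drop size_perm_word ltn_sub2r //.
exact: leq_ltn_trans lt_jk (ltn_ord k).
Qed.

Lemma psilly_rsilly n (p : 'S_n) : psilly p = rsilly (rev (perm_word p)).
Proof.
rewrite rsilly_count size_rev size_perm_word -card_ord_count /psilly [LHS]card_ord_rev.
apply: eq_card => j; rewrite !inE; set i := rev_ord j; set w := perm_word p.
have sz_w : size w = n by rewrite size_perm_word.
have lt_jn := ltn_ord j; have iE : nat_of_ord i = (n - j.+1)%N by [].
rewrite nth_rev ?sz_w // -iE nth_perm_word drop_rev sz_w -iE mem_rev.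
have sz_take : size (take i w) = i by rewrite size_takel // sz_w ltnW.
have nth_take_w (k : 'I_n) : (k < i)%N -> nth 0%N (take i w) k = p k.
  by move=> lt_ki; rewrite nth_take // nth_perm_word.
apply/and3P/andP => [[+ _ /existsP[k /andP[lt_ki /eqP pk]]]|[/(nthP 0%N)[k]]].
  rewrite -pk -[\val (p k)]/(nat_of_ord (p k)) -(nth_take_w k lt_ki).
  rewrite mem_nth ?sz_take // eqn0Ngt (leq_ltn_trans _ lt_ki) //=.
  move=> /existsP[i' /andP[/eqP i'E lt_p]]; split=> //.
  have lt_j1 : (j.+1 < size w)%N by rewrite sz_w; lia.
  have i'E2 : (n - j.+2)%N = nat_of_ord i' by lia.
  by rewrite nth_rev // sz_w i'E2 nth_perm_word.
rewrite sz_take => lt_ki wk lt_w; have lt_kn : (k < n)%N := ltn_trans lt_ki (ltn_ord i).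
move: wk; rewrite (nth_take_w (Ordinal lt_kn)) // => pk.
split; last by apply/existsP; exists (Ordinal lt_kn); rewrite lt_ki; apply/eqP.
  have lt_i : (i.-1 < n)%N by lia.
  (* The position [k] lies to the left of [i], so [i] is positive and has a left neighbour. *)
  apply/orP; right; apply/existsP; exists (Ordinal lt_i).
  apply/andP; split; first by apply/eqP => /=; lia.
  have lt_j1 : (j.+1 < size w)%N by rewrite sz_w; lia.
  have i1E : (n - j.+2)%N = nat_of_ord (Ordinal lt_i) by rewrite /=; lia.
  by move: lt_w; rewrite nth_rev // sz_w i1E nth_perm_word.
by rewrite -pk ltn_ord.
Qed.

Lemma uniq_map_inj (T U : eqType) (f : T -> U) (l : seq T) :
  uniq (map f l) -> {in l &, injective f}.
Proof.
elim: l => //= a l IHl /andP[fa uniq_l] b c; rewrite !inE.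
case/predU1P => [->|b_l] /predU1P[->|c_l] // fbc; last exact: IHl.
  by rewrite fbc map_f in fa.
by rewrite -fbc map_f in fa.
Qed.

Lemma code_word_inj c d : is_code 0 c -> is_code 0 d -> code_word c = code_word d -> c = d.
Proof.
move=> code_c code_d cd; have sz : size c = size d by rewrite -(size_code_word c) cd size_code_word.
have /perm_uniq := perm_words_codes (size d).
rewrite map_inj_uniq ?enum_uniq; last exact: perm_word_inj.
move/esym/uniq_map_inj; apply; rewrite ?mem_codes_from ?sz ?eqxx //.
by rewrite cd.
Qed.

Lemma perm_dsumA : associative perm_dsum.
Proof.
move=> u v w; rewrite /perm_dsum map_cat -map_comp catA size_cat size_map; congr (_ ++ _).
by apply: eq_map => e /=; rewrite addnA.
Qed.

Lemma perm_dsum0 : left_id [::] perm_dsum.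
Proof. by move=> w; rewrite /perm_dsum -[RHS]map_id. Qed.

Lemma rev_code_word_csum c d :
  rev (code_word (csum d c)) = perm_dsum (rev (code_word c)) (rev (code_word d)).
Proof. by rewrite code_word_csum rev_cat -map_rev /perm_dsum size_rev size_code_word. Qed.

Lemma is_perm_word_code c : is_code 0 c -> is_perm_word (rev (code_word c)).
Proof.
move=> code_c; have /perm_mem/(_ (rev (code_word c))) := perm_words_codes (size c).
rewrite [X in _ = X]map_f ?mem_codes_from ?eqxx // => /mapP[p _ ->].
by exists (size c), p.
Qed.

Lemma perm_dsum_code c a b : is_code 0 c -> is_perm_word a ->
  rev (code_word c) = perm_dsum a b ->
  exists d e, [/\ is_code 0 d, is_code 0 e, a = rev (code_word d), b = rev (code_word e)
    & c = csum e d].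
Proof.
move=> code_c [m [q aE]] cE; have perm_a := perm_word_iota m q; rewrite -aE in perm_a.
have sz_a : size a = m by rewrite aE size_perm_word.
have sz_c : (size c = m + size b)%N.
  by rewrite -size_code_word -size_rev cE size_cat size_map sz_a.
(* Cancelling [a], which uses the values below [m], leaves exactly the values from [m] on. *)
have perm_b : perm_eq b (iota 0 (size b)).
  apply: (perm_map_inj (@addnI m)); rewrite -iotaDl addn0 -(perm_cat2l a) -{1}sz_a.
  rewrite -[a ++ _]/(perm_dsum a b) -cE perm_rev (permPl (perm_code_word c)) sz_c iotaD perm_cat2r.
  by rewrite perm_sym.
have perm_surj v : perm_eq v (iota 0 (size v)) -> exists2 d, is_code 0 d & v = rev (code_word d).
  move=> perm_v; have [|d [code_d _ vE]] := code_word_surj (size v) (rev v).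
    by rewrite perm_rev.
  by exists d; rewrite // -vE revK.
have [d code_d dE] := perm_surj a ltac:(by rewrite sz_a).
have [e code_e eE] := perm_surj b perm_b.
exists d, e; split=> //; apply: code_word_inj => //; first by rewrite is_code_csum code_e.
by apply: (can_inj revK); rewrite rev_code_word_csum -dE -eE.
Qed.

Lemma comp_code_word c : is_code 0 c ->
  components is_perm_word [::] perm_dsum (rev (code_word c)) = ncuts c.
Proof.
apply: (@components_enc _ _ _ _ (fun c => rev (code_word c)) (fun c d => csum d c)) => {c}.
- exact: perm_dsumA.
- exact: perm_dsum0.
- by right.
- exact: is_perm_word_code.
- move=> c _; split=> [c0|->//]; apply/nilP.
  by rewrite /nilp -size_code_word -size_rev c0.
- by move=> c d _ _; apply: rev_code_word_csum.
exact: perm_dsum_code.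
Qed.

Lemma perm_code_sum (R : comNzRingType) (rr s x : R) n :
  \sum_(p : 'S_n) rr ^+ comp_perm p * s ^+ rmax p * x ^+ psilly p =
  code_csum _ rr (fun c => x ^+ rsilly (code_word c)) s n.
Proof.
pose F w := rr ^+ components is_perm_word [::] perm_dsum w * s ^+ lrmax 0 (rev w) * x ^+ rsilly (rev w).
transitivity (\sum_(w <- [seq perm_word p | p <- enum 'S_n]) F w).
  rewrite big_map big_enum; apply: eq_bigr => p _.
  by rewrite /F -rmax_lrmax -psilly_rsilly.
rewrite (perm_big _ (perm_words_codes n)) big_map; apply: eq_big_seq => c /codes_from_code code_c.
by rewrite /F comp_code_word // revK lrmax_foldl.
Qed.

(** * Matchings *)

(** Here [c] is the tail of a code from index [m] on, after the entry [prev]. Testing [m] against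
    the tail suffices, since earlier entries are below [m]. Starting with [prev = 0] excludes a
    descent at index 0. *)
Fixpoint unused_desc (m prev : nat) (c : seq nat) : nat :=
  if c is i :: c' then (((i < prev) && (m \notin c))%N + unused_desc m.+1 i c')%N else 0%N.

Lemma sorted_nth_ltn E p a : sorted ltn E -> (p < size E)%N ->
  (nth 0%N E p < a)%N = (p < count (fun e => e < a)%N E)%N.
Proof.
elim: E p => //= e E IHE p pathE lt_p.
have count0 : (a <= e)%N -> count (fun i => i < a)%N E = 0%N.
  move=> le_ae; rewrite -(@count_pred0 _ E); apply/eq_in_count => i iE.
  by have /allP/(_ i iE) /= := order_path_min ltn_trans pathE; lia.
case: (ltnP e a) => [lt_ea|le_ae]; last rewrite count0 //.
  by case: p lt_p => [|p] lt_p /=; rewrite ?lt_ea // add1n ltnS IHE ?(path_sorted pathE).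
rewrite ltn0; apply/negbTE; rewrite -leqNgt; case: p lt_p => //= p lt_p.
apply: leq_trans le_ae _.
by have /allP/(_ _ (mem_nth 0%N lt_p)) := order_path_min ltn_trans pathE; apply: ltnW.
Qed.

Lemma count_nth_ltn E p : sorted ltn E -> (p < size E)%N ->
  count (fun e => e < nth 0%N E p)%N E = p.
Proof.
move=> sortedE lt_p; have ltE := fun a q => sorted_nth_ltn E q a sortedE.
set k := count _ _; have le_k : (k <= size E)%N := count_size _ _.
apply/eqP; rewrite eqn_leq leqNgt -ltE // ltnn /= leqNgt.
apply/negP => lt_kp; have lt_k := ltn_trans lt_kp lt_p.
have := ltE (nth 0%N E p) k lt_k; rewrite -/k ltnn => /negbT/negP; apply.
by rewrite (sorted_ltn_nth ltn_trans) ?inE.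
Qed.

Section MatchingCodes.
Variables (K : comNzRingType) (s x : fps K).

(** [D] holds the values forbidden so far, by choosing [y] at descents, and [E] the values allowed
    for the next entry. The sum depends only on the size of [E] and on the rank of [prev] in it. *)
Lemma unused_desc_sum (D : seq nat) m n prev :
    0%N \notin D -> all (fun d => d < m)%N D -> (prev <= m)%N ->
  let E := [seq i <- iota 0 m.+1 | i \notin D] in
  \sum_(c <- codes_from m n | all (fun i => i \notin D) c)
    s ^+ count_mem 0%N c * x ^+ unused_desc m prev c =
  match_fut _ s (x - 1) n (size E) (count (fun e => e < prev)%N E).
Proof.
elim: n D m prev => [|n IHn] D m prev D0 D_lt le_prev E.
  by rewrite big_cons big_nil /=; ring.
have sortedE : sorted ltn E by rewrite sorted_filter ?iota_ltn_sorted //; apply: ltn_trans.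
have m_D : m \notin D by apply/negP => /(allP D_lt); rewrite ltnn.
have m1_D : m.+1 \notin D by apply/negP => /(allP D_lt); lia.
have EE : E = rcons [seq i <- iota 0 m | i \notin D] m.
  by rewrite /E -addn1 iotaD filter_cat /= m_D cats1.
(* The next index makes [m.+1] available; forbidding [m] at the same time keeps the number of
   allowed values. *)
have E1 : [seq i <- iota 0 m.+2 | i \notin D] = rcons E m.+1.
  by rewrite -addn1 iotaD filter_cat /= m1_D cats1.
have E2 : [seq i <- iota 0 m.+2 | i \notin m :: D] = rcons [seq i <- iota 0 m | i \notin D] m.+1.
  rewrite -addn2 iotaD filter_cat /= !inE eqxx eqn_leq ltnn /= m1_D cats1; congr rcons.
  by apply/eq_in_filter => i; rewrite mem_iota inE; case: eqP => // ->; lia.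
have nextE1 i : (i <= m)%N -> \sum_(c <- codes_from m.+1 n | all (fun i => i \notin D) c)
    s ^+ count_mem 0%N c * x ^+ unused_desc m.+1 i c =
    match_fut _ s (x - 1) n (size E).+1 (count (fun e => e < i)%N E).
  move=> le_im; rewrite IHn ?leqW //; last by apply: sub_all D_lt => d; apply: leqW.
  by rewrite E1 size_rcons -cats1 count_cat /= ltnNge (leqW le_im) !addn0.
have nextE2 i : (i <= m)%N -> (0 < m)%N ->
    \sum_(c <- codes_from m.+1 n | all (fun i => i \notin m :: D) c)
    s ^+ count_mem 0%N c * x ^+ unused_desc m.+1 i c =
    match_fut _ s (x - 1) n (size E) (count (fun e => e < i)%N E).
  move=> le_im m0; rewrite IHn ?leqW //; first last.
  - by rewrite /= ltnSn; apply: sub_all D_lt => d; apply: leqW.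
  - by rewrite inE negb_or D0 andbT; lia.
  by rewrite E2 EE !size_rcons -!cats1 !count_cat /= !ltnNge le_im (leqW le_im) !addn0.
(* A descent contributes $1 + (x-1)[m \notin c]$, and the second term forbids [m] in the rest of the
   code. *)
transitivity (\sum_(i <- E) slot_wt _ s i *
  (match_fut _ s (x - 1) n (size E).+1 (count (fun e => e < i)%N E) +
  (x - 1) * if (i < prev)%N then match_fut _ s (x - 1) n (size E) (count (fun e => e < i)%N E) else 0)).
  rewrite big_mkcond sum_codesS.
  rewrite big_filter -[iota 0 m.+1]/(index_iota 0 m.+1) big_mkord [RHS]big_mkcond.
  apply: eq_bigr => -[i /=]; rewrite ltnS => le_im _; case: ifP => i_D; last by rewrite big1.
  have wtE c : s ^+ ((i == 0%N) + count_mem 0%N c) = slot_wt _ s i * s ^+ count_mem 0%N c.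
    by case: (i) => [|i'] /=; rewrite ?exprS ?mul1r.
  rewrite -nextE1 // -big_mkcond mulrDr mulr_sumr.
  case: ltnP => lt_i; last first.
    by rewrite !mulr0 addr0; apply: eq_bigr => c _; rewrite wtE add0n mulrA.
  rewrite -nextE2 //; last by lia.
  rewrite !mulr_sumr [X in _ = _ + X]big_mkcond [X in _ = X + _]big_mkcond -big_split big_mkcond.
  apply: eq_bigr => c _ /=.
  have -> : all (fun i => i \notin m :: D) c = all (fun i => i \notin D) c && (m \notin c).
    by rewrite -has_pred1 -all_predC -all_predI; apply: eq_all => j; rewrite /= inE negb_or andbC.
  have /negPf m_i : m != i by lia.
  rewrite wtE inE m_i /=.
  case: all => /=; last by rewrite addr0.
  by case: (m \notin c); rewrite ?exprD ?expr0 ?expr1; ring.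
(* Reindexing by rank in [E]: the values below [prev] form an initial segment, and rank 0 is the
   value 0, so the weights agree. *)
rewrite (big_nth 0%N) big_mkord /= mulr_sumr (big_ord_widen (size E)
  (fun p => (x - 1) * (slot_wt _ s p * match_fut _ s (x - 1) n (size E) p))) ?count_size //.
rewrite [X in _ = _ + X]big_mkcond -big_split; apply: eq_bigr => -[p lt_p] _ /=.
rewrite count_nth_ltn // sorted_nth_ltn // (_ : slot_wt _ s (nth 0%N E p) = slot_wt _ s p).
  by case: ifP => _; ring.
have E_head : nth 0%N E 0 = 0%N by rewrite /E /= D0.
case: p lt_p => [|p] lt_p; first by rewrite E_head.
have := count_nth_ltn E p.+1 sortedE lt_p; case: (nth _ _ _) => //.
by rewrite (@eq_count _ _ pred0) ?count_pred0.
Qed.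

Lemma matching_code_sum :
  fpsum _ (code_sum _ (fun c => x ^+ unused_desc 0 0 c) s) = match_ser _ s (x - 1) 1 0.
Proof.
apply: eq_fpsum => n; have /= <- := @unused_desc_sum [::] 0 n 0 isT isT isT.
by rewrite big_mkcond; apply: eq_bigr => c _; rewrite all_predT.
Qed.
End MatchingCodes.

Lemma unused_desc_shift N m prev c :
  unused_desc (N + m) (N + prev) (map (addn N) c) = unused_desc m prev c.
Proof.
elim: c m prev => //= i c IHc m prev; rewrite ltn_add2l -addnS IHc.
by rewrite -map_cons mem_map //; apply: addnI.
Qed.

(** The junction is no descent, and the shifted entries exceed every index within [c]. *)
Lemma unused_desc_csum c d : is_code 0 c ->
  unused_desc 0 0 (csum c d) = (unused_desc 0 0 c + unused_desc 0 0 d)%N.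
Proof.
suff cat m prev : is_code m c -> (prev <= m)%N -> unused_desc m prev (c ++ map (addn (m + size c)) d)
    = (unused_desc m prev c + unused_desc 0 0 d)%N by move=> ?; apply: (cat 0%N 0%N).
elim: c m prev => [|i c IHc] m prev /=.
  case: d => //= j d _ le_prev; rewrite addn0 -[in X in unused_desc X]addn1 unused_desc_shift.
  by rewrite [(_ < prev)%N]ltnNge (leq_trans le_prev) ?leq_addr.
move=> /andP[le_im code_c] le_prev; rewrite addnS -addSn IHc ?leqW // addnA; congr (_ + _ + _)%N.
rewrite -cat_cons mem_cat negb_or; case: ltnP => //= _; congr (nat_of_bool _); rewrite andb_idr // => _.
by apply/mapP => -[j _]; lia.
Qed.

Lemma unused_descE c : is_code 0 c -> unused_desc 0 0 c =
  count (fun k => [&& 0 < k, nth 0%N c k < nth 0%N c k.-1 & k \notin c]%N) (iota 0 (size c)).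
Proof.
have gen m prev d : unused_desc m prev d =
    count (fun k => (nth 0%N d k < nth 0%N (prev :: d) k)%N &&
      ((m + k)%N \notin drop k d)) (iota 0 (size d)).
  elim: d m prev => // i d IHd m prev; rewrite [LHS]/= IHd /= addn0; congr (_ + _)%N.
  by rewrite (iotaDl 1 0) count_map; apply: eq_count => k /=; rewrite addnS.
move=> /is_codeP code_c; rewrite gen; apply/eq_in_count => -[|k]; first by rewrite ltn0.
rewrite mem_iota add0n => /= lt_k; case: ltnP => //= _.
rewrite add0n -[in RHS](cat_take_drop k.+1 c) mem_cat.
rewrite negb_or andb_idl // => _; apply/(nthP 0%N) => -[j].
rewrite size_takel ?(ltnW lt_k) // => lt_j.
rewrite nth_take // => eq_k; by have := code_c j (ltn_trans lt_j lt_k); rewrite eq_k add0n leqNgt lt_j.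
Qed.

(** * From codes to matchings *)

Section MatchingWord.
Variable c : seq nat.
Local Notation below a := (count (fun i => i < a)%N c).

(** The number of labels before the opener: [nth 0 c k] closers, the openers with a smaller entry,
    and those with the same entry and a smaller index. Within a run of openers the closers thus
    increase, as the absence of left nestings demands. *)
Definition opener k := (nth 0%N c k + below (nth 0%N c k) + count_mem (nth 0%N c k) (take k c))%N.
(** Before this closer there are [i] closers and the openers with entry at most [i]. *)
Definition closer i := (i + below i.+1)%N.
Definition matching_word := mkseq (fun k => (opener k, closer k)) (size c).

Lemma belowS a : below a.+1 = (below a + count_mem a c)%N.
Proof.
elim: c => //= i d ->; rewrite ltnS leq_eqVlt; case: eqP => [->|_]; rewrite ?ltnn /=; lia.
Qed.

Lemma leq_below a b : (a <= b)%N -> (below a <= below b)%N.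
Proof. by move=> le_ab; apply: sub_count => i /= /leq_trans; apply. Qed.

Lemma count_take_lt k : (k < size c)%N ->
  (count_mem (nth 0%N c k) (take k c) < count_mem (nth 0%N c k) c)%N.
Proof.
move=> lt_k; rewrite -[X in (_ < count _ X)%N](cat_take_drop k c) count_cat.
rewrite (drop_nth 0%N lt_k) /= eqxx; lia.
Qed.

Lemma opener_ge k : (nth 0%N c k + below (nth 0%N c k) <= opener k)%N.
Proof. exact: leq_addr. Qed.

Lemma opener_lt k : (k < size c)%N -> (opener k < nth 0%N c k + below (nth 0%N c k).+1)%N.
Proof. by move=> /count_take_lt lt_count; rewrite belowS /opener addnA ltn_add2l. Qed.

Lemma closer_opener i k : (k < size c)%N -> (closer i < opener k)%N = (i < nth 0%N c k)%N.
Proof.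
move=> lt_k; have := opener_ge k; have := opener_lt k lt_k; rewrite /closer.
case: (ltnP i) => [lt_i|le_i]; first by have := leq_below _ _ lt_i; lia.
by have := leq_below (nth 0%N c k).+1 i.+1 le_i; lia.
Qed.

Lemma opener_closer i k : (k < size c)%N -> (opener k < closer i)%N = (nth 0%N c k <= i)%N.
Proof.
move=> lt_k; have := opener_ge k; have := opener_lt k lt_k; rewrite /closer.
case: (leqP _ i) => [le_i|lt_i]; last by have := leq_below _ _ lt_i; lia.
by have := leq_below (nth 0%N c k).+1 i.+1 le_i; lia.
Qed.

Lemma opener_ltn k l : (k < size c)%N -> (l < size c)%N -> (opener k < opener l)%N =
  (nth 0%N c k < nth 0%N c l)%N || (nth 0%N c k == nth 0%N c l) && (k < l)%N.
Proof.
have lex a b : (a < size c)%N -> (b < size c)%N ->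
    (nth 0%N c a < nth 0%N c b)%N || (nth 0%N c a == nth 0%N c b) && (a < b)%N ->
    (opener a < opener b)%N.
  move=> lt_a lt_b /orP[lt_ab|/andP[/eqP eq_ab lt_ab]].
    by have := opener_ge b; have := opener_lt a lt_a; have := leq_below _ _ lt_ab; lia.
  have -> : opener b = (nth 0%N c a + below (nth 0%N c a) + count_mem (nth 0%N c a) (take b c))%N.
    by rewrite /opener eq_ab.
  rewrite ltn_add2l -(cat_take_drop a.+1 (take b c)) take_takel // count_cat.
  by rewrite (take_nth 0%N lt_a) -cats1 count_cat /= eqxx; lia.
move=> lt_k lt_l; apply/idP/idP; last exact: lex.
apply: contraLR; rewrite negb_or negb_and -!leqNgt => /andP[le_lk neq_lk].
have [->//|neq] := eqVneq k l; apply/ltnW/lex => //.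
by case: ltngtP le_lk neq_lk => //= _ _; rewrite ltn_neqAle eq_sym neq.
Qed.

Lemma ltn_closer i j : (closer i < closer j)%N = (i < j)%N.
Proof.
have mono a b : (a < b)%N -> (closer a < closer b)%N.
  by move=> lt_ab; rewrite /closer; have := leq_below a.+1 b.+1 (ltnW lt_ab); lia.
by case: (ltngtP i j) => [/mono->|/mono/ltnW|->]; rewrite ?ltnn // ltnNge => ->.
Qed.

Lemma closer_lt i : (i < size c)%N -> (closer i < (size c).*2)%N.
Proof. by rewrite /closer => lt_i; have := count_size (fun j => j < i.+1)%N c; lia. Qed.
End MatchingWord.

Definition arc_wf n (w : seq (nat * nat)) :=
  [&& size w == n, perm_eq (unzip1 w ++ unzip2 w) (iota 0 n.*2), sorted ltn (unzip2 w)
    & all (fun a => a.1 < a.2)%N w].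

Definition left_nested (a b : nat * nat) := (a.1 == b.1.+1) && (a.2 < b.2)%N.

Definition arc_nln (w : seq (nat * nat)) := all (fun a => all (fun b => ~~ left_nested a b) w) w.

Definition code_of (w : seq (nat * nat)) := [seq count (fun a => a.2 < b.1)%N w | b <- w].

Lemma matching_wordK c : is_code 0 c -> code_of (matching_word c) = c.
Proof.
move=> /is_codeP code_c; apply: (@eq_from_nth _ 0%N); rewrite ?size_map ?size_iota // => k lt_k.
rewrite (nth_map (0%N, 0%N)) ?size_mkseq // nth_mkseq // count_map.
rewrite (@eq_count _ _ (fun i => i < nth 0%N c k)%N) => [|i]; last by rewrite /= closer_opener.
have := code_c k lt_k; rewrite add0n => le_k.
by rewrite -size_filter (filter_iota_ltn 0) ?size_iota //; lia.
Qed.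

Lemma matching_word_wf c : is_code 0 c -> arc_wf (size c) (matching_word c).
Proof.
move=> /is_codeP code_c; rewrite /arc_wf size_mkseq eqxx /=.
have w1 : unzip1 (matching_word c) = mkseq (opener c) (size c) by rewrite /unzip1 -map_comp.
have w2 : unzip2 (matching_word c) = mkseq (closer c) (size c) by rewrite /unzip2 -map_comp.
have lt_oc k : (k < size c)%N -> (opener c k < closer c k)%N.
  by move=> lt_k; rewrite opener_closer // code_c.
apply/and3P; split.
- rewrite w1 w2.
  set l := _ ++ _; have uniq_l : uniq l.
    rewrite cat_uniq; apply/and3P; split.
    + apply/mkseq_uniqP => k l'; rewrite !inE => lt_k lt_l eq_o.
      have := opener_ltn c k l' lt_k lt_l; have := opener_ltn c l' k lt_l lt_k.
      by rewrite eq_o !ltnn eq_sym; case: ltngtP => //= _; case: ltngtP.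
    + apply/hasPn => _ /mapP[i _ ->]; apply/mapP => -[k]; rewrite mem_iota => lt_k eq_co.
      have := closer_opener c i k lt_k; have := opener_closer c i k lt_k.
      by rewrite eq_co !ltnn; case: ltnP.
    apply/mkseq_uniqP => i j _ _ eq_c.
    by have := ltn_closer c i j; have := ltn_closer c j i; rewrite eq_c !ltnn; case: ltngtP.
  have sub_l : {subset l <= iota 0 (size c).*2}.
    move=> v; rewrite mem_cat mem_iota /= add0n => /orP[] /mapP[k]; rewrite mem_iota => lt_k ->.
      by apply: ltn_trans (lt_oc k lt_k) _; apply: closer_lt.
    exact: closer_lt.
  have sz_l : (size (iota 0 (size c).*2) <= size l)%N.
    by rewrite size_cat !size_mkseq size_iota addnn.
  have [_ eq_l] := uniq_min_size uniq_l sub_l sz_l.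
  exact: uniq_perm uniq_l (iota_uniq _ _) eq_l.
- rewrite w2; apply: homo_sorted (iota_ltn_sorted _ _) => i j.
  by rewrite /= ltn_closer.
by apply/allP => _ /mapP[k + ->]; rewrite mem_iota => lt_k; apply: lt_oc.
Qed.

(** If arc [l] closes after arc [k] but opens just before it, then its entry is smaller, and the
    closer of index [nth 0 c l] would lie strictly between the two adjacent openers. *)
Lemma matching_word_nln c : is_code 0 c -> arc_nln (matching_word c).
Proof.
move=> /is_codeP code_c.
apply/allP => _ /mapP[k + ->]; rewrite mem_iota add0n => /= lt_k.
apply/allP => _ /mapP[l + ->]; rewrite mem_iota add0n => /= lt_l.
rewrite /left_nested /= ltn_closer; apply/negP => /andP[/eqP oE lt_kl].
have := opener_ltn c k l lt_k lt_l; rewrite {1}oE ltnNge leqnSn lt_kl andbT.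
case: ltngtP => //= lt_c _.
have := closer_opener c (nth 0%N c l) k lt_k; have := opener_closer c (nth 0%N c l) l lt_l.
by rewrite lt_c leqnn; lia.
Qed.

Lemma count_nth (T : Type) (x0 : T) (P : pred T) (l : seq T) :
  count P l = count (fun i => P (nth x0 l i)) (iota 0 (size l)).
Proof. by rewrite -{1}(mkseq_nth x0 l) count_map. Qed.

(** * From matchings without left nestings to codes *)

Section WordCode.
Variables (n : nat) (w : seq (nat * nat)).
Hypotheses (w_wf : arc_wf n w) (w_nln : arc_nln w).
Let o k := nth 0%N (unzip1 w) k.
Let d k := nth 0%N (unzip2 w) k.
Let c k := nth 0%N (code_of w) k.

Let sz_w : size w = n. Proof. by case/and4P: w_wf => /eqP. Qed.
Let sz1 : size (unzip1 w) = n. Proof. by rewrite size_map. Qed.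
Let sz2 : size (unzip2 w) = n. Proof. by rewrite size_map. Qed.
Let perm_w : perm_eq (unzip1 w ++ unzip2 w) (iota 0 n.*2). Proof. by case/and4P: w_wf. Qed.
Let sorted_w : sorted ltn (unzip2 w). Proof. by case/and4P: w_wf. Qed.

Let uniq_w : uniq (unzip1 w ++ unzip2 w).
Proof. by rewrite (perm_uniq perm_w) iota_uniq. Qed.

Let o_lt k : (k < n)%N -> (o k < n.*2)%N.
Proof.
move=> lt_k; have : o k \in iota 0 n.*2 by rewrite -(perm_mem perm_w) mem_cat mem_nth ?sz1.
by rewrite mem_iota.
Qed.

Let d_lt k : (k < n)%N -> (d k < n.*2)%N.
Proof.
move=> lt_k; have : d k \in iota 0 n.*2 by rewrite -(perm_mem perm_w) mem_cat mem_nth ?sz2 ?orbT.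
by rewrite mem_iota.
Qed.

Let oN k : (k < n)%N -> (nth (0%N, 0%N) w k).1 = o k.
Proof. by move=> lt_k; rewrite /o (nth_map (0%N, 0%N)) ?sz_w. Qed.

Let dN k : (k < n)%N -> (nth (0%N, 0%N) w k).2 = d k.
Proof. by move=> lt_k; rewrite /d (nth_map (0%N, 0%N)) ?sz_w. Qed.

Let lt_od k : (k < n)%N -> (o k < d k)%N.
Proof.
move=> lt_k; have /and4P[_ _ _ /allP/(_ (nth (0%N, 0%N) w k))] := w_wf.
by rewrite mem_nth ?sz_w // oN // dN // => ->.
Qed.

Let cE k : (k < n)%N -> c k = count (fun v => v < o k)%N (unzip2 w).
Proof.
move=> lt_k; by rewrite /c (nth_map (0%N, 0%N)) ?sz_w // count_map oN.
Qed.

Let countE v : (v <= n.*2)%N ->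
  (count (fun u => u < v)%N (unzip1 w) + count (fun u => u < v)%N (unzip2 w))%N = v.
Proof.
by move=> le_v; rewrite -count_cat (seq.permP perm_w) -size_filter (filter_iota_ltn 0) ?size_iota.
Qed.

Let d_ltE i v : (i < n)%N -> (d i < v)%N = (i < count (fun u => u < v)%N (unzip2 w))%N.
Proof. by move=> lt_i; rewrite /d sorted_nth_ltn ?sz2. Qed.

Let neq_od k i : (k < n)%N -> (i < n)%N -> o k != d i.
Proof.
move=> lt_k lt_i; apply/eqP => eq_od; move: uniq_w; rewrite cat_uniq => /and3P[_ /hasPn/(_ (d i))].
by rewrite mem_nth ?sz2 // -eq_od mem_nth ?sz1 // => /(_ isT).
Qed.

Let o_dE k i : (k < n)%N -> (i < n)%N -> (o k < d i)%N = (c k <= i)%N.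
Proof.
move=> lt_k lt_i; rewrite [RHS]leqNgt cE // -d_ltE // -leqNgt [RHS]leq_eqVlt.
by rewrite (negPf (neq_od _ _ lt_k lt_i)).
Qed.

Let o_inj k l : (k < n)%N -> (l < n)%N -> o k = o l -> k = l.
Proof.
move=> lt_k lt_l /eqP; rewrite nth_uniq ?sz1 //; first by move/eqP.
by move: uniq_w; rewrite cat_uniq => /and3P[].
Qed.

Let c_mono k l : (k < n)%N -> (l < n)%N -> (o k <= o l)%N -> (c k <= c l)%N.
Proof. by move=> lt_k lt_l le_o; rewrite !cE //; apply: sub_count => v /= /leq_trans; apply. Qed.

(* No closer separates the openers [o k] and [o l], so all positions in between carry openers,
   and the absence of left nestings makes the closers increase along such a run. *)
Let run k l : (k < n)%N -> (l < n)%N -> c k = c l -> (o k < o l)%N -> (k < l)%N.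
Proof.
have [j] := ubnP (o l - o k)%N; elim: j k => // j IHj k lt_j lt_k lt_l eq_c lt_o.
have : (o k).+1 \in unzip1 w ++ unzip2 w.
  by rewrite (perm_mem perm_w) mem_iota add0n (leq_ltn_trans lt_o) ?o_lt.
rewrite mem_cat => /orP[] /(nthP 0%N)[m]; rewrite ?sz1 ?sz2 => lt_m.
  rewrite -/(o m) => oE; have lt_km : (k < m)%N.
    have neq_km : k != m by apply/eqP => km; move: oE; rewrite km; lia.
    have /allP/(_ (nth (0%N, 0%N) w m)) := w_nln; rewrite mem_nth ?sz_w // => /(_ isT).
    move=> /allP/(_ (nth (0%N, 0%N) w k)); rewrite mem_nth ?sz_w // => /(_ isT).
    rewrite /left_nested !oN // !dN // oE eqxx d_ltE // count_nth_ltn ?sz2 //= -leqNgt.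
    by rewrite leq_eqVlt (negPf neq_km).
  have := oE; have [<- //|neq_ml] := eqVneq m l => _.
  have lt_ml : (o m < o l)%N.
    rewrite ltn_neqAle oE lt_o andbT; apply: contra neq_ml => /eqP eq_o.
    by apply/eqP/o_inj => //; rewrite oE.
  apply: ltn_trans lt_km (IHj m _ _ _ _ _) => //; first by lia.
  apply/eqP; rewrite eqn_leq c_mono //= ?(ltnW lt_ml) // -eq_c c_mono // oE.
  exact: leqnSn.
rewrite -/(d m) => dE.
have := o_dE k m lt_k lt_m; have := o_dE l m lt_l lt_m; rewrite eq_c dE ltnSn => <-.
by rewrite ltnS leqNgt lt_o.
Qed.

Let o_ltE l k : (l < n)%N -> (k < n)%N ->
  (o l < o k)%N = (c l < c k)%N || (c l == c k) && (l < k)%N.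
Proof.
move=> lt_l lt_k; case: (ltngtP (c l) (c k)) => [lt_c|lt_c|eq_c] /=.
- by rewrite ltnNge; apply/negP => /(c_mono _ _ lt_k lt_l); rewrite leqNgt lt_c.
- apply/negbTE; rewrite -leqNgt leqNgt; apply/negP => /ltnW/(c_mono _ _ lt_l lt_k).
  by rewrite leqNgt lt_c.
apply/idP/idP; first exact: run.
move=> lt_lk; rewrite ltnNge leq_eqVlt; apply/negP => /orP[/eqP/(o_inj _ _ lt_k lt_l) eq_lk|].
  by rewrite eq_lk ltnn in lt_lk.
by move/(run _ _ lt_k lt_l (esym eq_c)); rewrite ltnNge ltnW.
Qed.

Lemma code_of_code : is_code 0 (code_of w).
Proof.
apply/is_codeP => k; rewrite size_map sz_w add0n => lt_k.
by rewrite -/(c k) -o_dE // lt_od.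
Qed.

Let sz_c : size (code_of w) = n. Proof. by rewrite size_map. Qed.

(** A label equals the number of labels below it. By [o_ltE] and [o_dE] this number is given by the
    code, as in [opener] and [closer]. *)
Lemma code_ofK : matching_word (code_of w) = w.
Proof.
have countc P : count P (code_of w) = count (fun i => P (c i)) (iota 0 n).
  by rewrite (count_nth _ 0%N) sz_c.
have openerE k : (k < n)%N -> opener (code_of w) k = o k.
  move=> lt_k; rewrite -[RHS](countE _ (ltnW (o_lt k lt_k))) -cE // [RHS]addnC /opener -/(c k).
  rewrite -addnA; congr (_ + _)%N; rewrite (count_nth _ 0%N _ (unzip1 w)) sz1 -/o countc.
  have -> : count_mem (c k) (take k (code_of w)) =
      count (fun l => (c l == c k) && (l < k)%N) (iota 0 n).
    rewrite (count_nth _ 0%N _ (take k _)) size_takel ?sz_c ?(ltnW lt_k) //.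
    rewrite -(subnKC (ltnW lt_k)) iotaD count_cat add0n.
    rewrite [X in (_ + X)%N](@eq_in_count _ _ pred0) ?count_pred0 ?addn0.
      apply: eq_in_count => l; rewrite mem_iota add0n => /= lt_l.
      by rewrite nth_take // lt_l andbT.
    by move=> l; rewrite mem_iota => /andP[le_kl _] /=; rewrite ltnNge le_kl andbF.
  rewrite -count_predUI [X in (_ + X)%N](@eq_count _ _ pred0) ?count_pred0 ?addn0.
    apply: eq_in_count => l; rewrite mem_iota add0n => /= lt_l.
    by rewrite /predU /= o_ltE.
  by move=> l /=; case: ltngtP.
have closerE i : (i < n)%N -> closer (code_of w) i = d i.
  move=> lt_i; rewrite -[RHS](countE _ (ltnW (d_lt i lt_i))) count_nth_ltn ?sz2 // addnC /closer.
  congr (_ + _)%N; rewrite countc (count_nth _ 0%N _ (unzip1 w)) sz1.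
  apply: eq_in_count => l; rewrite mem_iota add0n => /= lt_l.
  by rewrite ltnS -/(o l) o_dE.
apply: (@eq_from_nth _ (0%N, 0%N)); rewrite size_mkseq sz_c ?sz_w // => k lt_k.
by rewrite nth_mkseq ?sz_c // openerE // closerE // -oN // -dN //; case: nth.
Qed.
End WordCode.

Lemma is_code_lt c : is_code 0 c -> all (fun i => i < size c)%N c.
Proof.
move=> /is_codeP code_c; apply/(all_nthP 0%N) => k lt_k.
exact: leq_ltn_trans (code_c k lt_k) _.
Qed.

Lemma matching_word_csum c d : is_code 0 c ->
  matching_word (csum c d) = matching_dsum (matching_word c) (matching_word d).
Proof.
move=> code_c; have /allP lt_c := is_code_lt c code_c.
have below_l a : (a <= size c)%N ->
    count (fun i => i < a)%N (csum c d) = count (fun i => i < a)%N c.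
  move=> le_a; rewrite count_cat count_map [X in (_ + X)%N](@eq_count _ _ pred0).
    by rewrite count_pred0 addn0.
  move=> i.
  by rewrite /=; lia.
have below_r a : count (fun i => i < size c + a)%N (csum c d) = (size c + count (fun i => i < a)%N d)%N.
  rewrite count_cat count_map; congr (_ + _)%N.
    by apply/eqP; rewrite -all_count; apply/allP => i /lt_c /=; lia.
  by apply: eq_count => i /=; rewrite ltn_add2l.
rewrite {1}/matching_word /mkseq size_csum iotaD map_cat add0n.
rewrite /matching_dsum size_mkseq; congr (_ ++ _).
  apply/eq_in_map => k; rewrite mem_iota add0n => /= lt_k.
  have le_ck : (nth 0%N c k <= size c)%N by apply/ltnW/lt_c/mem_nth.
  by rewrite /opener /closer !below_l // /csum nth_cat lt_k ?below_l // takel_cat // ltnW.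
rewrite /matching_word /mkseq -[RHS]map_comp -[in LHS](addn0 (size c)) iotaDl -map_comp.
apply/eq_in_map => k; rewrite mem_iota add0n => /= lt_k.
rewrite /opener /closer -addnS !below_r nth_cat ltnNge leq_addr /= addKn (nth_map 0%N) // below_r.
rewrite take_cat ltnNge leq_addr /= addKn -map_take count_cat count_map.
rewrite (_ : count_mem _ c = 0%N); last by apply/count_memPn/negP => /lt_c; lia.
rewrite (@eq_count _ (preim _ _) (pred1 (nth 0%N d k))) => [|i]; last by rewrite /= eqn_add2l.
by rewrite -addnn add0n; congr (_, _); ring.
Qed.

Lemma matching_dsumA : associative matching_dsum.
Proof.
move=> u v w; rewrite /matching_dsum map_cat -map_comp catA size_cat size_map; congr (_ ++ _).
by apply: eq_map => e /=; rewrite doubleD !addnA.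
Qed.

Lemma matching_dsum0 : left_id [::] matching_dsum.
Proof. by move=> w; rewrite /matching_dsum -[RHS]map_id; apply: eq_map => -[]. Qed.

(** * Matchings as sets of arcs and as arc words *)

Section ArcSets.
Variable n : nat.
Implicit Types (A : {set 'I_n.*2}) (M : {set {set 'I_n.*2}}).

Lemma opcl_set2 (a b : 'I_n.*2) : (a < b)%N ->
  op [set a; b] = a /\ cl [set a; b] = b.
Proof.
have le_op v : (v <= n.*2)%N -> (v <= op [set a; b])%N = [forall i in [set a; b], (v <= i)%N].
  by move=> le_v; rewrite /op (big_morph (fun m => v <= m)%N (leq_min v) le_v) big_andE.
move=> lt_ab; split; apply/eqP; rewrite eqn_leq; apply/andP; split.
- rewrite leqNgt le_op ?ltn_ord //; apply/negP => /forall_inP/(_ a).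
  by rewrite set21 ltnn => /(_ isT).
- rewrite le_op ?(ltnW (ltn_ord a)) //; apply/forall_inP => i; rewrite !inE => /orP[] /eqP-> //.
  exact: ltnW.
- by apply/bigmax_leqP => i; rewrite !inE => /orP[] /eqP-> //; apply: ltnW.
by apply: (leq_bigmax_cond (F := fun i : 'I_n.*2 => val i)); rewrite set22.
Qed.

Lemma arc_set2 M A : is_matching M -> A \in M ->
  exists a b : 'I_n.*2, [/\ (a < b)%N, A = [set a; b], op A = a & cl A = b].
Proof.
move=> /andP[_ /forall_inP card2] A_M; have /cards2P[a [b [neq_ab AE]]] := card2 A A_M.
wlog lt_ab : a b neq_ab AE / (a < b)%N.
  move=> H; case: (ltngtP a b) => [lt_ab|lt_ba|/val_inj eq_ab].
  - exact: (H a b).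
  - by apply: (H b a); rewrite 1?eq_sym // setUC.
  by rewrite eq_ab eqxx in neq_ab.
by exists a, b; have [opA clA] := opcl_set2 a b lt_ab; rewrite AE opA clA.
Qed.

Lemma mem_arcs M A : (A \in arcs M) = (A \in M).
Proof. by rewrite mem_sort mem_enum. Qed.

Lemma size_arcs M : size (arcs M) = #|M|.
Proof. by rewrite size_sort -cardE. Qed.

Lemma card_matching M : is_matching M -> #|M| = n.
Proof.
move=> /andP[partM /forall_inP card2].
have /(_ _ partM) := @card_uniform_partition _ 2 _ _ (fun A AM => eqP (card2 A AM)).
by rewrite cardsT card_ord muln2 => /double_inj.
Qed.

Lemma size_arc_word M : is_matching M -> size (arc_word M) = n.
Proof. by move=> M_ok; rewrite size_map size_arcs card_matching. Qed.

Lemma arc_word_wf M : is_matching M -> arc_wf n (arc_word M).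
Proof.
move=> M_ok; rewrite /arc_wf size_arc_word // eqxx /=.
have w1 : unzip1 (arc_word M) = map (@op n) (arcs M) by rewrite /unzip1 -map_comp.
have w2 : unzip2 (arc_word M) = map (@cl n) (arcs M) by rewrite /unzip2 -map_comp.
set l := _ ++ _; have sub_l : {subset iota 0 n.*2 <= l}.
  move=> v; rewrite mem_iota add0n => /= lt_v.
  have /and3P[/eqP coverM _ _] := proj1 (andP M_ok).
  have : Ordinal lt_v \in cover M by rewrite coverM inE.
  case/bigcupP => A A_M; have [a [b [_ AE opA clA]]] := arc_set2 M A M_ok A_M.
  rewrite {1}AE !inE /l w1 w2 mem_cat => /orP[] /eqP v_eq.
    by rewrite (_ : v = op A) ?map_f ?mem_arcs // opA -v_eq.
  by rewrite [X in _ || X](_ : _ = true) ?orbT // (_ : v = cl A) ?map_f ?mem_arcs // clA -v_eq.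
have sz_l : (size l <= size (iota 0 n.*2))%N.
  by rewrite size_cat !size_map size_arcs card_matching // size_iota addnn.
have uniq_l : uniq l := leq_size_uniq (iota_uniq _ _) sub_l sz_l.
have [_ eq_l] := uniq_min_size (iota_uniq _ _) sub_l sz_l.
apply/and3P; split.
- by apply: uniq_perm uniq_l (iota_uniq _ _) _ => v; rewrite eq_l.
- rewrite ltn_sorted_uniq_leq; apply/andP; split; first by move: uniq_l; rewrite cat_uniq => /and3P[].
  by rewrite w2 sorted_map; apply: sort_sorted => A B; apply: leq_total.
apply/allP => _ /mapP[A + ->]; rewrite mem_arcs => /(arc_set2 M A M_ok)[a [b [lt_ab _ -> ->]]].
by [].
Qed.

Definition arc_of (a : nat * nat) : {set 'I_n.*2} := [set i | (val i == a.1) || (val i == a.2)].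

Lemma arc_ofK M A : is_matching M -> A \in M -> arc_of (op A, cl A) = A.
Proof.
move=> M_ok A_M; have [a [b [_ AE opA clA]]] := arc_set2 M A M_ok A_M.
by apply/setP => i; rewrite AE -{1}AE -{1}AE opA clA !inE.
Qed.

Lemma arc_word_inj M N : is_matching M -> is_matching N -> arc_word M = arc_word N -> M = N.
Proof.
have arcsE M' : is_matching M' -> arcs M' = map arc_of (arc_word M').
  move=> M_ok; rewrite -map_comp -[LHS]map_id; apply/eq_in_map => A.
  by rewrite mem_arcs => A_M; rewrite /= (arc_ofK M').
move=> M_ok N_ok eq_w; apply/setP => A; rewrite -!mem_arcs !arcsE //.
by rewrite eq_w.
Qed.

Lemma arc_of_set2 a : (a.1 < a.2)%N -> (a.2 < n.*2)%N ->
  exists i j : 'I_n.*2, [/\ val i = a.1, val j = a.2, (i < j)%N & arc_of a = [set i; j]].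
Proof.
move=> lt_a lt_a2; exists (Ordinal (ltn_trans lt_a lt_a2)), (Ordinal lt_a2); split=> //.
by apply/setP => i; rewrite !inE.
Qed.

Lemma arc_word_surj w : arc_wf n w -> exists2 M : {set {set 'I_n.*2}}, is_matching M & arc_word M = w.
Proof.
move=> /and4P[/eqP sz_w perm_w sorted_w /allP lt_w].
have lt2_w a : a \in w -> (a.2 < n.*2)%N.
  move=> a_w; have : a.2 \in iota 0 n.*2.
    by rewrite -(perm_mem perm_w) mem_cat orbC map_f.
  by rewrite mem_iota.
have set2 a (a_w : a \in w) := arc_of_set2 a (lt_w a a_w) (lt2_w a a_w).
have opcl a : a \in w -> (op (arc_of a), cl (arc_of a)) = a.
  move=> a_w; have [i [j [ia ja lt_ij ->]]] := set2 a a_w.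
  by have [-> ->] := opcl_set2 i j lt_ij; rewrite [nat_of_ord i]ia [nat_of_ord j]ja -surjective_pairing.
pose M := [set A in map arc_of w].
have MP A : reflect (exists2 a, a \in w & A = arc_of a) (A \in M) by rewrite inE; apply: mapP.
have uniq_w : uniq (unzip1 w ++ unzip2 w) by rewrite (perm_uniq perm_w) iota_uniq.
have M_ok : is_matching M.
  apply/andP; split; last first.
    apply/forall_inP => _ /MP[a a_w ->]; have [i [j [_ _ lt_ij ->]]] := set2 a a_w.
    by rewrite cards2 (_ : i != j) //; apply: contraTneq lt_ij => ->; rewrite ltnn.
  apply/and3P; split.
  - apply/eqP/setP => i; rewrite inE; apply/bigcupP.
    have : val i \in iota 0 n.*2 by rewrite mem_iota add0n /= ltn_ord.
    rewrite -(perm_mem perm_w) mem_cat => /orP[] /mapP[a a_w ia].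
      by exists (arc_of a); [apply/MP; exists a | rewrite inE ia eqxx].
    by exists (arc_of a); [apply/MP; exists a | rewrite inE ia eqxx orbT].
  - apply/trivIsetP => _ _ /MP[a a_w ->] /MP[b b_w ->]; apply: contraR => /pred0Pn[i /=].
    rewrite !inE => /andP[ia ib]; apply/eqP; congr arc_of.
    have [uniq1 disj uniq2] : [/\ uniq (unzip1 w), ~~ has (mem (unzip1 w)) (unzip2 w) & uniq (unzip2 w)].
      by apply/and3P; rewrite -cat_uniq.
    case/orP: ia => /eqP ia; case/orP: ib => /eqP ib; move: ib; rewrite ia => eq_ab.
    - exact: (uniq_map_inj _ _ _ _ uniq1 a b a_w b_w eq_ab).
    - by case/hasP: disj; exists b.2; rewrite ?map_f //= -eq_ab map_f.
    - by case/hasP: disj; exists a.2; rewrite ?map_f //= eq_ab map_f.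
    exact: (uniq_map_inj _ _ _ _ uniq2 a b a_w b_w eq_ab).
  apply/negP => /MP[a a_w /setP A0]; have [i [j [_ _ _ aE]]] := set2 a a_w.
  by have := A0 i; rewrite aE inE set21.
(* Both words are strictly sorted by closer, so having the same arcs makes them equal. *)
exists M => //; apply: (@irr_sorted_eq _ (fun a b => a.2 < b.2)%N).
- by move=> a b c; apply: ltn_trans.
- by move=> a; apply: ltnn.
- by have /and4P[_ _ + _] := arc_word_wf M M_ok; rewrite sorted_map.
- by move: sorted_w; rewrite sorted_map.
move=> a; apply/mapP/idP => [[A]|a_w].
  by rewrite mem_arcs => /MP[b b_w ->] ->; rewrite opcl.
by exists (arc_of a); rewrite ?opcl // mem_arcs; apply/MP; exists a.
Qed.
End ArcSets.

(** * Statistics and components of matchings on codes *)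

Section MatchingCount.
Variable n : nat.
Implicit Type M : {set {set 'I_n.*2}}.

Lemma mem_noLeftNestings M :
  (M \in noLeftNestings n) = is_matching M && arc_nln (arc_word M).
Proof.
rewrite inE; apply: andb_id2l => M_ok; rewrite /arc_nln all_map.
rewrite negb_exists; apply/forallP/allP => [nln A|nln A].
  rewrite mem_arcs => A_M; rewrite /= all_map; apply/allP => B; rewrite mem_arcs => B_M /=.
  have := nln A; rewrite A_M /= negb_exists => /forallP/(_ B); rewrite B_M /=; apply: contra.
  have [a [b [lt_ab _ opA clA]]] := arc_set2 n M A M_ok A_M.
  rewrite /left_nested /left_nesting /= => /andP[/eqP oE ->].
  by rewrite oE ltnSn eqxx -oE opA clA lt_ab.
rewrite negb_and; case A_M: (A \in M) => //=; rewrite negb_exists; apply/forallP => B.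
rewrite negb_and; case B_M: (B \in M) => //=.
have := nln A; rewrite mem_arcs A_M => /(_ isT); rewrite /= all_map => /allP/(_ B).
rewrite mem_arcs B_M => /(_ isT); apply: contra.
by case/and4P=> _ _ lt_cl oE; rewrite /left_nested /= oE lt_cl.
Qed.

Lemma arc_words_codes :
  perm_eq [seq arc_word M | M <- enum (noLeftNestings n)] [seq matching_word c | c <- codes_from 0 n].
Proof.
have in_nln M : M \in enum (noLeftNestings n) -> is_matching M /\ arc_nln (arc_word M).
  by rewrite mem_enum mem_noLeftNestings => /andP[].
apply: uniq_perm => [||w].
- rewrite map_inj_in_uniq ?enum_uniq // => M N /in_nln[M_ok _] /in_nln[N_ok _].
  exact: arc_word_inj.
- rewrite map_inj_in_uniq ?codes_from_uniq // => c d /codes_from_code code_c /codes_from_code code_d.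
  by move/(congr1 code_of); rewrite !matching_wordK.
apply/mapP/mapP => [[M /in_nln[M_ok M_nln] ->]|[c + ->]].
  have M_wf := arc_word_wf n M M_ok; exists (code_of (arc_word M)).
    by rewrite mem_codes_from size_map size_arc_word // eqxx (code_of_code n).
  by rewrite (code_ofK n).
rewrite mem_codes_from => /andP[/eqP sz_c code_c].
have := matching_word_wf c code_c; rewrite sz_c => /(arc_word_surj n)[M M_ok ME].
by exists M; rewrite // mem_enum mem_noLeftNestings M_ok ME matching_word_nln.
Qed.

Lemma nth_arc_word M c k : is_matching M -> arc_word M = matching_word c -> (k < n)%N ->
  [/\ size c = n, op (Defs.arc M k) = opener c k & cl (Defs.arc M k) = closer c k].
Proof.
move=> M_ok ME lt_k; have sz_c : size c = n.
  by rewrite -(size_arc_word n M M_ok) ME size_mkseq.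
have : nth (0%N, 0%N) (arc_word M) k = (op (Defs.arc M k), cl (Defs.arc M k)).
  by rewrite (nth_map set0) // size_arcs card_matching.
by rewrite ME nth_mkseq ?sz_c // => -[-> ->].
Qed.

Lemma min_stat_code M c : is_matching M -> arc_word M = matching_word c ->
  min_stat M = count_mem 0%N c.
Proof.
move=> M_ok ME; have arcE := nth_arc_word M c _ M_ok ME.
have sz_c : size c = n by rewrite -(size_arc_word n M M_ok) ME size_mkseq.
rewrite (count_nth _ 0%N) sz_c -card_ord_count; apply: eq_card => i; rewrite !inE.
have [_ -> _] := arcE i (ltn_ord i); have [_ _ ->] := arcE 0%N (leq_ltn_trans (leq0n i) (ltn_ord i)).
by rewrite opener_closer ?sz_c // leqn0.
Qed.

(** The opener condition for consecutive arcs is a descent of the code. The closers of index [i] and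
    [i.+1] are adjacent iff no opener lies between them, that is, iff no entry equals [i.+1]. *)
Lemma rne_code M c : is_matching M -> is_code 0 c -> arc_word M = matching_word c ->
  rne M = unused_desc 0 0 c.
Proof.
move=> M_ok code_c ME; have arcE := nth_arc_word M c _ M_ok ME.
have sz_c : size c = n by rewrite -(size_arc_word n M M_ok) ME size_mkseq.
rewrite unused_descE // sz_c -card_ord_count; apply: eq_card => -[[|i] lt_i]; rewrite !inE //=.
have lt_i' := ltnW lt_i; have [_ -> ->] := arcE i.+1 lt_i; have [_ -> ->] := arcE i lt_i'.
rewrite opener_ltn ?sz_c // [(i.+1 < i)%N](_ : _ = false) ?andbF ?orbF; last by lia.
congr (_ && _).
have := is_codeP 0 c code_c i; rewrite opener_closer ?sz_c // => -> //=.
by rewrite /closer (belowS c i.+1); apply/eqP/count_memPn; move: (count _ c) (count _ c); lia.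
Qed.

Lemma comp_matching_word c : is_code 0 c ->
  components is_arc_word [::] matching_dsum (matching_word c) = ncuts c.
Proof.
apply: (@components_enc _ _ _ _ matching_word csum) => {c}.
- exact: matching_dsumA.
- exact: matching_dsum0.
- by left.
- move=> c code_c; have [M M_ok ME] := arc_word_surj _ _ (matching_word_wf c code_c).
  by exists (size c), M.
- by move=> [|i c] _.
- by move=> c d code_c _; apply: matching_word_csum.
move=> c a b code_c [m [M [M_ok aE]]] cE.
have sz_a : size a = m by rewrite aE size_arc_word.
have sz_c : size c = (m + size b)%N 
  by move/(congr1 size): cE; rewrite size_mkseq size_cat size_map sz_a.
have nth_c k : (k < size c)%N -> nth (0%N, 0%N) (matching_dsum a b) k = (opener c k, closer c k).
  by move=> lt_k; rewrite -cE nth_mkseq.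
(* The closer of index [m.-1] is a label of [a], hence below [m.*2], whereas the openers from index
   [m] on are at least [m.*2]. So their entries exceed [m.-1]. *)
have cut_c : cut c m.
  apply/(all_nthP 0%N) => k; rewrite size_drop nth_drop => lt_k.
  case: (posnP m) => [->//|m_gt0].
  have lt_mk : (m + k < size c)%N by lia.
  suff : (m.-1 < nth 0%N c (m + k))%N by lia.
  rewrite -closer_opener //.
  have lt_m1 : (m.-1 < size c)%N by lia.
  have := nth_c _ lt_m1; rewrite nth_cat sz_a prednK // leqnn => nthE.
  have -> : closer c m.-1 = (nth (0%N, 0%N) a m.-1).2 by rewrite nthE.
  have := nth_c (m + k)%N lt_mk; rewrite nth_cat sz_a ltnNge leq_addr /= addKn.
  rewrite (nth_map (0%N, 0%N)) => [[<- _]|]; last by rewrite -(ltn_add2l m) -sz_c.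
  have /and4P[_ /perm_mem perm_a _ _] := arc_word_wf m M M_ok.
  apply: leq_trans (leq_addr _ _); move: (perm_a (nth (0%N, 0%N) a m.-1).2).
  rewrite -aE mem_cat orbC map_f ?mem_nth ?sz_a ?prednK // mem_iota.
  by move/esym => /andP[].
have [|d cE2 /andP[code_t code_d]] := cut_split c m code_c cut_c; first by rewrite sz_c leq_addr.
have sz_t : size (take m c) = m by rewrite size_takel // sz_c leq_addr.
exists (take m c), d; move: cE; rewrite cE2 matching_word_csum // /matching_dsum => /eqP.
rewrite eqseq_cat ?size_mkseq ?sz_t // sz_a => /andP[/eqP <- /eqP]; rewrite -cE2.
(* The shift of labels is injective, so [b] is recovered from the equal shifted suffixes. *)
move/(@inj_map _ _ _ _) => H; split=> //; apply/esym/H => -[u1 u2] [v1 v2] /= [/addnI -> /addnI ->] //.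
Qed.

Lemma matching_code_csum (R : comNzRingType) (rr s x : R) :
  \sum_(M in noLeftNestings n) rr ^+ comp_matching M * s ^+ min_stat M * x ^+ rne M =
  code_csum _ rr (fun c => x ^+ unused_desc 0 0 c) s n.
Proof.
pose F w := let c := code_of w in
  rr ^+ components is_arc_word [::] matching_dsum w * s ^+ count_mem 0%N c * x ^+ unused_desc 0 0 c.
transitivity (\sum_(w <- [seq arc_word M | M <- enum (noLeftNestings n)]) F w).
  rewrite big_map big_enum; apply: eq_bigr => M; rewrite mem_noLeftNestings => /andP[M_ok M_nln].
  have M_wf := arc_word_wf n M M_ok; have ME := code_ofK n _ M_wf M_nln.
  have code_M := code_of_code n _ M_wf.
  by rewrite /F (min_stat_code M _ M_ok (esym ME)) (rne_code M _ M_ok code_M (esym ME)).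
rewrite (perm_big _ arc_words_codes) big_map; apply: eq_big_seq => c /codes_from_code code_c.
by rewrite /F matching_wordK // comp_matching_word.
Qed.
End MatchingCount.

(** * The generating functions *)

Section MainTheorem.
Variables (K : comNzRingType) (r s x : fps K).
Hypothesis x1_unit : x - 1 \is a GRing.unit.
Local Notation t := (fpsX K).

Lemma prod_series1E : prod_series _ 1 (x - 1) =
  sum_from1 (fun m => \prod_(1 <= k < m.+1) ((x - 1)^-1 * ((1 + t * (x - 1)) ^+ k - 1))).
Proof.
congr sum_from1; apply: boolp.funext => m; apply: eq_big_nat => -[//|k] _.
by rewrite subn1 mul1r -exprSr.
Qed.

(** By the functional equation at weight 1, the sum of products is a multiple of t, so the
    denominator has constant coefficient 1. *)
Lemma prod_series_den_unit : 1 + (1 - r) * prod_series _ 1 (x - 1) \is a GRing.unit.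
Proof.
have -> : prod_series _ 1 (x - 1) = t * perm_ser _ (x - 1) (1 + 1 + 1 * (t * (x - 1))) 1 0.
  apply: (addrI 1); rewrite -perm_ser_refined_prod // perm_ser_funeq; ring.
apply: fps_unit_coef1; rewrite coef_fpsD mulrCA coef_fpsXM.
by rewrite addr0.
Qed.

(** The two families differ only in the statistic [X] on codes; its additivity makes [x ^+ X c]
    multiplicative under [csum]. *)
Lemma code_sum_series (X : seq nat -> nat) :
    (forall c d, is_code 0 c -> is_code 0 d -> X (csum c d) = (X c + X d)%N) ->
    X [::] = 0%N ->
    (forall s', fpsum _ (code_sum _ (fun c => x ^+ X c) s') = 1 + prod_series _ s' (x - 1)) ->
  sum_from1 (fun n => t ^+ n * code_csum _ r (fun c => x ^+ X c) s n) =
    r * prod_series _ s (x - 1) / (1 + (1 - r) * prod_series _ 1 (x - 1)).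
Proof.
move=> Xcsum X0 XE; apply: code_series => //.
- by move=> c d code_c code_d; rewrite Xcsum // exprD.
- by rewrite X0.
exact: prod_series_den_unit.
Qed.

Lemma perm_series :
  sum_from1 (fun n => t ^+ n *
    \sum_(p : 'S_n) r ^+ comp_perm p * s ^+ rmax p * x ^+ psilly p) =
  r * prod_series _ s (x - 1) / (1 + (1 - r) * prod_series _ 1 (x - 1)).
Proof.
rewrite -(code_sum_series (fun c => rsilly (code_word c))) //.
- by congr sum_from1; apply: boolp.funext => n; rewrite perm_code_sum.
- by move=> c d _ _; apply: rsilly_csum.
by move=> s'; rewrite code_word_sum perm_ser_refined_prod.
Qed.

Lemma matching_series :
  sum_from1 (fun n => t ^+ n *
    \sum_(M in noLeftNestings n) r ^+ comp_matching M * s ^+ min_stat M * x ^+ rne M) =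
  r * prod_series _ s (x - 1) / (1 + (1 - r) * prod_series _ 1 (x - 1)).
Proof.
rewrite -(code_sum_series (unused_desc 0 0)) //.
- by congr sum_from1; apply: boolp.funext => n; rewrite matching_code_csum.
- by move=> c d code_c _; apply: unused_desc_csum.
by move=> s'; rewrite matching_code_sum match_ser_refined_prod.
Qed.

Lemma matching_series_prod :
  sum_from1 (fun n => t ^+ n *
    \sum_(M in noLeftNestings n) r ^+ comp_matching M * s ^+ min_stat M * x ^+ rne M) =
  r * prod_series _ s (x - 1) / (1 + (1 - r) * sum_from1 (fun m =>
    \prod_(1 <= k < m.+1) ((x - 1)^-1 * ((1 + t * (x - 1)) ^+ k - 1)))).
Proof. by rewrite matching_series prod_series1E. Qed.
End MainTheorem.

Theorem theorem5p5 :
  sum_from1 (fun n => t ^+ n *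
    \sum_(p : 'S_n) r ^+ comp_perm p * s ^+ rmax p * x ^+ psilly p)
  = sum_from1 (fun n => t ^+ n *
    \sum_(M in noLeftNestings n)
      r ^+ comp_matching M * s ^+ min_stat M * x ^+ rne M)
  /\
  sum_from1 (fun n => t ^+ n *
    \sum_(M in noLeftNestings n)
      r ^+ comp_matching M * s ^+ min_stat M * x ^+ rne M)
  = (r * sum_from1 (fun m => \prod_(1 <= k < m.+1)
           ((x - 1)^-1 *
            ((1 + t * (x - 1)) ^+ (k - 1) * (1 + s * t * (x - 1)) - 1))))
    / (1 + (1 - r) * sum_from1 (fun m => \prod_(1 <= k < m.+1)
           ((x - 1)^-1 * ((1 + t * (x - 1)) ^+ k - 1)))).
Proof.
split; last exact: matching_series_prod coefField r s x x1_unit.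
exact: etrans (perm_series coefField r s x x1_unit) (esym (matching_series coefField r s x x1_unit)).
Qed.
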